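(* Let $q=p^m$, where $p$ is prime and $m$ is a positive integer. Let $a,b,c,d\in\mathbb{F}_{q^2}$ be not all zero, and put $D(x)=ax^3+bx^2+cx+d$, $N(x)=d^qx^3+c^qx^2+b^qx+a^q$ and $g(x)=\frac{N(x)}{D(x)}\in\mathbb{F}_{q^2}(x)$. Let criteria (I) and (II) on $(a,b,c,d)$ be the ones defined in the context. The polynomial $h(x)=ax^{3q}+bx^{2q+1}+cx^{q+2}+dx^3$ is a permutation polynomial over $\mathbb{F}_{q^2}$ if and only if $\gcd(3,q-1)=1$ and one of the following holds: (1) $\deg(g)=3$, the characteristic of $\mathbb{F}_q$ is not $3$, and criterion (I) holds; (2) $g$ is separable of degree $3$, the characteristic of $\mathbb{F}_q$ is $3$, and criterion (II) holds; (3) $\deg(g)=3$, the characteristic of $\mathbb{F}_q$ is $3$, $g$ is not separable, and $d^{q+1}\neq a^{q+1}$; (4) $\deg(g)=1$, and $H(x)=\gcd(D(x),N(x))$ has no roots in $\mu_{q+1}$.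
   Context: $\mu_{q+1}$ denotes the set of $(q+1)$-th roots of unity in $\mathbb{F}_{q^2}$. A polynomial over a finite field is a permutation polynomial if it induces a bijection of the field. A rational function is identified with its reduced form $N_0/D_0$ with $N_0,D_0$ coprime; its degree is $\max(\deg N_0,\deg D_0)$. A nonconstant $g(x)\in K(x)$ is separable if the extension $K(x)/K(g(x))$ is separable; equivalently, $g(x)\notin K(x^p)$ with $p=\operatorname{char}K$. ''Is a nonsquare of $\mathbb{F}_q^{*}$'' means: lies in $\mathbb{F}_q^{*}$ and is not a square there. A condition involving a quotient includes the requirement that its denominator is nonzero. Criterion (I) (characteristic $\neq 3$). Both of the following hold. (I.a) $bd^q\neq ac^q$, and, with $A=\frac{cd^q-ab^q}{bd^q-ac^q}$, either (i) $cd^q\neq ab^q$ and, with $B=\frac{c^qd-a^qb}{cd^q-ab^q}$, one has $A^2+2B=\frac{c^{q+1}-b^{q+1}+3d^{q+1}-3a^{q+1}}{bd^q-ac^q}$ and $B^2=\frac{b^qd-a^qc}{bd^q-ac^q}$; or (ii) $cd^q=ab^q$ (so $A=0$) and, with $B=\frac{c^{q+1}-b^{q+1}+3d^{q+1}-3a^{q+1}}{2(bd^q-ac^q)}$, one has $B^2=\frac{b^qd-a^qc}{bd^q-ac^q}$ (this alternative requires division by $2$ and is regarded as not satisfied in characteristic $2$). (I.b) Let $Q(x)=(ad+bc)x^2+(a^{q+1}+b^{q+1}+c^{q+1}+d^{q+1})x+(a^qd^q+b^qc^q)$ if the characteristic is $2$, and $Q(x)=(3ac-b^2)x^2+(2bc^q-3d^qc-3ab^q)x+3d^qb^q-c^{2q}$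 if the characteristic is neither $2$ nor $3$. Either $\gcd(3,q-1)=1$ and $Q(x)=0$ has a root in $\mu_{q+1}$, or $\gcd(3,q+1)=1$ and $Q(x)=0$ has no roots in $\mu_{q+1}$. Criterion (II) (characteristic $3$). Let $\alpha=\frac{cd^q-ab^q}{bd^q-ac^q}$, $\beta=\frac{c^q}{b}$, and fix $\gamma\in\mathbb{F}_{q^2}$ of multiplicative order $q+1$. Then $bd^q\neq ac^q$, $\alpha^3=\frac{c^qd-a^qb}{bd^q-ac^q}$, $\alpha,\beta\in\mu_{q+1}$, and, with $A_1=d^q\alpha^3+c^q\alpha^2+b^q\alpha+a^q$ and $B_1=a\alpha^3+b\alpha^2+c\alpha+d$, one of the following holds: (II.1) $\alpha\notin\mathbb{F}_q$, $\beta\notin\mathbb{F}_q$, and $\frac{B_3-\beta A_3}{\beta A_1-B_1}$ is a nonsquare of $\mathbb{F}_q^{*}$, where $A_3=c^q(2\alpha^2+1)+b^q(2\alpha+\alpha^3)$, $B_3=b(2\alpha^2+1)+c(2\alpha+\alpha^3)$; (II.2) $\alpha\notin\mathbb{F}_q$, $\beta\in\mathbb{F}_q$, and $\frac{\beta\alpha^qB_3-\alpha A_3}{\alpha A_1-\beta\alpha^qB_1}$ is a nonsquare of $\mathbb{F}_q^{*}$, with $A_3,B_3$ given by the formulas in (II.1); (II.3) $\alpha\in\mathbb{F}_q$, $\beta\notin\mathbb{F}_q$, and $\frac{B_3-\beta A_3}{\beta A_1-B_1}$ is a nonsquare of $\mathbb{F}_q^{*}$, where $A_3=c^q(2\alpha^2+\alpha^2\beta^{q-1})+b^q(2\alpha+\alpha\beta^2)$,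 $B_3=b(2\alpha^2+\alpha^2\beta^{q-1})+c(2\alpha+\alpha\beta^2)$; (II.4) $\alpha\in\mathbb{F}_q$, $\beta\in\mathbb{F}_q$, and $\frac{\beta\gamma^qB_3-\gamma A_3}{\gamma A_1-\beta\gamma^qB_1}$ is a nonsquare of $\mathbb{F}_q^{*}$, where $A_3=c^q(2\alpha^2+\alpha^2\gamma^{q-1})+b^q(2\alpha+\alpha\gamma^2)$, $B_3=b(2\alpha^2+\alpha^2\gamma^{q-1})+c(2\alpha+\alpha\gamma^2)$. *)

(* Defs.v *)
(* Library: Mathematical Components. *)
From HB Require Import structures.
From mathcomp Require Import all_boot all_order all_algebra all_field.

Set Implicit Arguments.
Unset Strict Implicit.
Unset Printing Implicit Defensive.

Import GRing.Theory.
Local Open Scope ring_scope.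

(* K(x) is {fraction {poly K}}; the chosen representative [repr g] of a fraction
   need not be reduced, so the gcd is divided out. *)
Definition reduced_num (K : fieldType) (g : {fraction {poly K}}) : {poly K} :=
  \n_(repr g) %/ gcdp \n_(repr g) \d_(repr g).

Definition reduced_den (K : fieldType) (g : {fraction {poly K}}) : {poly K} :=
  \d_(repr g) %/ gcdp \n_(repr g) \d_(repr g).

Definition rat_degree (K : fieldType) (g : {fraction {poly K}}) : nat :=
  maxn (size (reduced_num g)).-1 (size (reduced_den g)).-1.

Definition eval_at (K : fieldType) (u : {poly K}) (g : {fraction {poly K}}) :
    {fraction {poly K}} :=
  (map_poly (fun k : K => tofrac k%:P) u).[g].

(* z lies in the subfield K(g) of K(x) *)
Definition in_adjoin (K : fieldType) (g z : {fraction {poly K}}) : Prop :=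
  exists u v : {poly K}, eval_at v g != 0 /\ z = eval_at u g / eval_at v g.

(* The extension K(x)/K(g) is separable: every element of K(x) is a root of a
   separable polynomial over K(g).  [separable_poly P] forces P != 0, so this
   includes algebraicity. *)
Definition rat_separable (K : fieldType) (g : {fraction {poly K}}) : Prop :=
  forall z : {fraction {poly K}},
  exists P : {poly {fraction {poly K}}},
    [/\ forall i, in_adjoin g P`_i, separable_poly P & root P z].

Definition permutation_poly (F : finFieldType) (h : {poly F}) : Prop :=
  bijective (fun x : F => h.[x]).

(* For a finite field F with q ^ 2 elements, its subfield F_q consists of the
   elements fixed by the q-th power map. *)
Definition in_Fq (F : fieldType) (q : nat) (x : F) : Prop := x ^+ q = x.

Definition nonsquare_Fq (F : fieldType) (q : nat) (z : F) : Prop :=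
  [/\ in_Fq q z, z != 0 & ~ (exists2 y : F, in_Fq q y & y ^+ 2 = z)].

(* u / v is a nonsquare of F_q^*, with the convention that this requires
   v != 0 *)
Definition nonsquare_quotient (F : fieldType) (q : nat) (u v : F) : Prop :=
  v != 0 /\ nonsquare_Fq q (u / v).

Definition polyD (F : fieldType) (a b c d : F) : {poly F} :=
  a *: 'X^3 + b *: 'X^2 + c *: 'X + d%:P.

Definition polyN (F : fieldType) (q : nat) (a b c d : F) : {poly F} :=
  (d ^+ q) *: 'X^3 + (c ^+ q) *: 'X^2 + (b ^+ q) *: 'X + (a ^+ q)%:P.

Definition rat_g (F : fieldType) (q : nat) (a b c d : F) : {fraction {poly F}} :=
  tofrac (polyN q a b c d) / tofrac (polyD a b c d).

Definition poly_h (F : fieldType) (q : nat) (a b c d : F) : {poly F} :=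
  a *: 'X^(3 * q) + b *: 'X^(2 * q + 1) + c *: 'X^(q + 2) + d *: 'X^3.

Definition criterion_Ia (F : fieldType) (q : nat) (a b c d : F) : Prop :=
  let M := b * d ^+ q - a * c ^+ q in
  let L := c * d ^+ q - a * b ^+ q in
  let S := c ^+ (q + 1) - b ^+ (q + 1) + 3 * d ^+ (q + 1) - 3 * a ^+ (q + 1) in
  let T := b ^+ q * d - a ^+ q * c in
  let A := L / M in
  b * d ^+ q != a * c ^+ q /\
  ((let B := (c ^+ q * d - a ^+ q * b) / L in
    [/\ c * d ^+ q != a * b ^+ q, A ^+ 2 + 2 * B = S / M & B ^+ 2 = T / M])
   \/
   (let B := S / (2 * M) in
    [/\ c * d ^+ q = a * b ^+ q, 2%N \notin [pchar F] & B ^+ 2 = T / M])).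

Definition polyQ (F : fieldType) (q : nat) (a b c d : F) : {poly F} :=
  if 2%N \in [pchar F] then
    (a * d + b * c) *: 'X^2
    + (a ^+ (q + 1) + b ^+ (q + 1) + c ^+ (q + 1) + d ^+ (q + 1)) *: 'X
    + (a ^+ q * d ^+ q + b ^+ q * c ^+ q)%:P
  else
    (3 * a * c - b ^+ 2) *: 'X^2
    + (2 * b * c ^+ q - 3 * d ^+ q * c - 3 * a * b ^+ q) *: 'X
    + (3 * d ^+ q * b ^+ q - c ^+ (2 * q))%:P.

Definition has_root_in_mu (F : fieldType) (q : nat) (P : {poly F}) : Prop :=
  exists2 x : F, (q.+1).-unity_root x & root P x.

Definition criterion_Ib (F : fieldType) (q : nat) (a b c d : F) : Prop :=
  (gcdn 3 (q - 1) = 1%N /\ has_root_in_mu q (polyQ q a b c d)) \/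
  (gcdn 3 (q + 1) = 1%N /\ ~ has_root_in_mu q (polyQ q a b c d)).

Definition criterion_I (F : fieldType) (q : nat) (a b c d : F) : Prop :=
  criterion_Ia q a b c d /\ criterion_Ib q a b c d.

Definition criterion_II (F : fieldType) (q : nat) (gamma a b c d : F) : Prop :=
  let M := b * d ^+ q - a * c ^+ q in
  let alpha := (c * d ^+ q - a * b ^+ q) / M in
  let beta := c ^+ q / b in
  let A1 := d ^+ q * alpha ^+ 3 + c ^+ q * alpha ^+ 2 + b ^+ q * alpha + a ^+ q in
  let B1 := a * alpha ^+ 3 + b * alpha ^+ 2 + c * alpha + d in
  (* A_3 and B_3 are c^q u + b^q v and b u + c v respectively, where (u, v)
     depends on the case. *)
  let A3 u v := c ^+ q * u + b ^+ q * v in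
  let B3 u v := b * u + c * v in
  [/\ b * d ^+ q != a * c ^+ q,
      alpha ^+ 3 = (c ^+ q * d - a ^+ q * b) / M,
      (q.+1).-unity_root alpha,
      b != 0 /\ (q.+1).-unity_root beta
    & [\/ [/\ ~ in_Fq q alpha, ~ in_Fq q beta
            & let u := 2 * alpha ^+ 2 + 1 in
              let v := 2 * alpha + alpha ^+ 3 in
              nonsquare_quotient q (B3 u v - beta * A3 u v) (beta * A1 - B1)],
          [/\ ~ in_Fq q alpha, in_Fq q beta
            & let u := 2 * alpha ^+ 2 + 1 in
              let v := 2 * alpha + alpha ^+ 3 in
              nonsquare_quotient q
                (beta * alpha ^+ q * B3 u v - alpha * A3 u v)
                (alpha * A1 - beta * alpha ^+ q * B1)],
          [/\ in_Fq q alpha, ~ in_Fq q beta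
            & let u := 2 * alpha ^+ 2 + alpha ^+ 2 * beta ^+ (q - 1) in
              let v := 2 * alpha + alpha * beta ^+ 2 in
              nonsquare_quotient q (B3 u v - beta * A3 u v) (beta * A1 - B1)]
        | [/\ in_Fq q alpha, in_Fq q beta
            & let u := 2 * alpha ^+ 2 + alpha ^+ 2 * gamma ^+ (q - 1) in
              let v := 2 * alpha + alpha * gamma ^+ 2 in
              nonsquare_quotient q
                (beta * gamma ^+ q * B3 u v - gamma * A3 u v)
                (gamma * A1 - beta * gamma ^+ q * B1)]]].

(* Main.v *)
Require Import Defs.
From HB Require Import structures.
From mathcomp Require Import all_boot all_order all_algebra all_field.
From mathcomp Require Import cyclic ring zify.

Set Implicit Arguments.
Unset Strict Implicit.
Unset Printing Implicit Defensive.

Import GRing.Theory.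
Local Open Scope ring_scope.

(** Write s for the q-th power map of F and mu for the elements x with x * s x = 1,
    the (q+1)-th roots of unity.  In h(X) the pair (X ^ q, X) enters as the pair of
    variables of a binary cubic form, so h(k X) = k ^ 3 h(X) for k in F_q, and
    h(X) ^ (q - 1) = g(X ^ (q - 1)).  Hence h permutes F exactly when every element
    of F_q has one cube root ([fixed_cube]), D has no zero on mu and g is injective
    on mu ([permutation_polyP]).  The common factors of N and D are stable under
    x |-> s(x) ^ -1, which excludes degrees 0 and 2 and settles degree 1.

    Degree three is the heart of the matter.  Suppose that g is injective on mu and
    that the fibre of some x0 in mu is not x0 counted three times.  The other two
    points of that fibre are z and s(z) ^ -1, off mu.  An F_q-linear substitution in
    X acts on mu as a Moebius map and moves x0, z, s(z) ^ -1 to 1, 0, infinity.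
    Then 1 / (g - g(1)) is, up to a constant factor,
      a x + (a + b) - d / x + e / (x - 1),
    and its values on mu minus 1 fill an affine line over F_q, whose small power
    sums vanish.  The first power sum gives d = a; the second one, or the third in
    characteristic two, gives e = - a ([normalized_coefs]).  So up to these
    substitutions there is only one g: the pencil spanned by N and D is the one
    spanned by x ^ 3 - 3 x + 1 and x ^ 2 - x, and it contains (x - r) ^ 3 for both
    roots r of x ^ 2 - x + 1.  The points r lie on mu because 3 divides q + 1 or
    is zero in F.  In all cases some point of mu is totally ramified, and two of
    them are when 3 is not zero ([ramification_point_exists],
    [two_ramification_points]).

    If 3 is not zero, the pencil of N and D is spanned by (x - u) ^ 3 and
    (x - v) ^ 3 with u, v on mu.  Criterion (I.a) says that the 2 by 2 minors of the
    coefficients of N and D are proportional to those of such a pair, with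
    A = - (u + v) and B = u v; the roots of Q are the two branch values, so (I.b)
    says that u and v are on mu.  Conversely g(x) = g(y) then means that the cross
    ratio of x, y, u, v is a cube root of unity; it is in F_q, so it is 1
    ([cube_pencil_injective]).

    If 3 is zero and al is a totally ramified point, put z = 1 / (x - al), which
    carries mu minus al to an affine line over F_q.  A polynomial of degree three in
    z is injective there only if it has no term in z ^ 2, and for z + eps z ^ 3
    injectivity says that - 1 / eps is not the square of a difference of two points
    of the line.  Each quotient in criterion (II) is - w ^ 2 / eps, where w is a
    convenient element with w ^ (q - 1) = - al ^ -2, and being a nonsquare of F_q
    says precisely this ([criterion_IIP]).

    Degrees of rational functions are read off numerators and denominators in
    [rat_degree_quotient].  Separability of F(x) over F(g) is shown to be the
    nonvanishing of the derivative of g ([rat_separableP]). *)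

(** * Cubic forms over a field with an involution *)

(** With [eqM] and [eqD] this lets a proof name an explicit linear combination of
    known equations; what remains is a polynomial identity for [ring] or [field]. *)
Lemma lin_eq (V : zmodType) (x y l r : V) : l = r -> x - y = l - r -> x = y.
Proof. by move=> -> /eqP; rewrite subrr subr_eq0 => /eqP. Qed.

Lemma eqM (R : pzRingType) (k l r : R) : l = r -> k * l = k * r.
Proof. by move=> ->. Qed.

Lemma eqD (V : zmodType) (l r l' r' : V) : l = r -> l' = r' -> l + l' = r + r'.
Proof. by move=> -> ->. Qed.

(** The non-vanishing conditions that [field] leaves are looked up in the context. *)
Ltac fld := field;
  repeat match goal with H : is_true (_ != 0) |- _ => progress rewrite ?H end;
  rewrite ?oner_eq0 ?oppr_eq0 ?mulN1r //=;
  repeat match goal with H : is_true (_ != 0) |- _ => progress rewrite ?H end.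

(** The form is kept homogeneous so that zero and infinity, which the involution
    exchanges, are on the same footing. *)
Definition cform (R : pzRingType) (a b c d u v : R) : R :=
  a * u ^+ 3 + b * u ^+ 2 * v + c * u * v ^+ 2 + d * v ^+ 3.

Section Involution.
Variables (F : fieldType) (s : {rmorphism F -> F}).
Hypothesis sK : involutive s.

Definition unitary (x : F) := x * s x = 1.

Lemma unitary_neq0 x : unitary x -> x != 0.
Proof.
by move=> ux; apply/eqP => x0; move/eqP: ux; rewrite x0 mul0r eq_sym oner_eq0.
Qed.

Lemma unitary_conj x : unitary x -> s x = x^-1.
Proof.
by move=> ux; apply: (mulfI (unitary_neq0 ux)); rewrite ux mulfV ?unitary_neq0.
Qed.

(** Injectivity of g = N / D on mu, cross-multiplied: if [cform a b c d] is D then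
    the form with coefficients s d, s c, s b, s a is N. *)
Definition injective_on_unitary (a b c d : F) :=
  forall x y, unitary x -> unitary y ->
  cform (s d) (s c) (s b) (s a) x 1 * cform a b c d y 1 =
  cform (s d) (s c) (s b) (s a) y 1 * cform a b c d x 1 -> x = y.

Definition only_trivial_cube_root := forall x : F, s x = x -> x ^+ 3 = 1 -> x = 1.

(** The quadratic relation between the six minors of a 2 by 4 matrix factors under
    these hypotheses; the excluded factor is the case of a common quadratic factor
    x ^ 2 + A x + B of D and N. *)
Lemma minor_dichotomy (a b c d A B : F) :
  let M := b * s d - a * s c in
  c * s d - a * s b = A * M -> s c * d - s a * b = A * B * M ->
  c * s c - b * s b + 3 * (d * s d - a * s a) = (A ^+ 2 + 2 * B) * M ->
  s b * d - s a * c = B ^+ 2 * M ->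
  d * s d - a * s a != B * M ->
  3 * (d * s d - a * s a) = (A ^+ 2 - B) * M.
Proof.
move=> M hL hsL hS hT hpi.
have pl : (B * M - (d * s d - a * s a)) *
   (B * M + 3 * (d * s d - a * s a) - A ^+ 2 * M) = 0.
  have e : M * (s b * d - s a * c) - (c * s d - a * s b) * (s c * d - s a * b)
    + (d * s d - a * s a) * (c * s c - b * s b) = 0 by rewrite /M; ring.
  move: e hS; rewrite hL hsL hT => e hS.
  apply: (lin_eq (eqD e (eqM (-(d * s d - a * s a)) hS))).
  move: M {e hL hsL hS hT hpi} => M; ring.
move/eqP: pl; rewrite mulf_eq0 => /orP[/eqP e | /eqP e].
  by case/eqP: hpi; apply: (lin_eq (eqM (-1) e)); ring.
by apply: (lin_eq e); ring.
Qed.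

(** The minors determine the span of D and N, and D itself is the element of the
    span with given coefficients of x ^ 3 and x ^ 2; likewise for N. *)
Lemma pencil_of_minors (a b c d A B : F) :
  let M := b * s d - a * s c in
  M != 0 ->
  c * s d - a * s b = A * M -> s c * d - s a * b = A * B * M ->
  c * s c - b * s b + 3 * (d * s d - a * s a) = (A ^+ 2 + 2 * B) * M ->
  s b * d - s a * c = B ^+ 2 * M ->
  d * s d - a * s a != B * M ->
  [/\ c = b * A - 3 * a * B, 3 * d = b * (A ^+ 2 - B) - 3 * a * A * B,
      s b = s c * A - 3 * s d * B & 3 * s a = s c * (A ^+ 2 - B) - 3 * s d * A * B].
Proof.
move=> M M0 hL hsL hS hT hpi.
have h3p : 3 * (d * s d - a * s a) = (A ^+ 2 - B) * M.
  exact: minor_dichotomy hL hsL hS hT hpi.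
have hp21 : c * s c - b * s b = 3 * B * M.
  by apply: (lin_eq (eqD hS (eqM (-1) h3p))); ring.
split; apply: (mulIf M0).
- by apply: (lin_eq (eqD (eqM b hL) (eqM (-a) hp21))); rewrite /M; ring.
- by apply: (lin_eq (eqD (eqM b h3p) (eqM (- 3 * a) hsL))); rewrite /M; ring.
- by apply: (lin_eq (eqD (eqM (s c) hL) (eqM (- s d) hp21))); rewrite /M; ring.
- by apply: (lin_eq (eqD (eqM (s c) h3p) (eqM (- 3 * s d) hsL))); rewrite /M; ring.
Qed.

(** The hypothesis on t makes N - t D a multiple of (x - w) ^ 3 with w on mu.  The
    other root v of x ^ 2 + A x + B is on mu as well, the pencil is spanned by the
    cubes of x - w and x - v, and g(x) = g(y) says that a cross ratio of x, y, w, v,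
    an element of the fixed field, has cube 1. *)
Lemma cube_pencil_injective (a b c d A B t : F) :
  3 != 0 :> F -> only_trivial_cube_root ->
  let M := b * s d - a * s c in
  M != 0 ->
  c * s d - a * s b = A * M -> s c * d - s a * b = A * B * M ->
  c * s c - b * s b + 3 * (d * s d - a * s a) = (A ^+ 2 + 2 * B) * M ->
  s b * d - s a * c = B ^+ 2 * M ->
  d * s d - a * s a != B * M ->
  unitary t ->
  (s c - t * b) ^+ 2 - 3 * A * (s c - t * b) * (s d - t * a)
    + 9 * B * (s d - t * a) ^+ 2 = 0 ->
  injective_on_unitary a b c d.
Proof.
move=> n3 cub M M0 hL hsL hS hT hpi ut hQ.
have h3p : 3 * (d * s d - a * s a) = (A ^+ 2 - B) * M.
  exact: minor_dichotomy hL hsL hS hT hpi.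
have [hc hd hc' hd'] := pencil_of_minors M0 hL hsL hS hT hpi.
set c3 := s d - t * a in hQ *; set c2 := s c - t * b in hQ *.
have c30 : c3 != 0.
  apply: contraNneq M0 => e3; move/eqP: hQ.
  rewrite e3 mulr0 expr0n /= mulr0 subr0 addr0 sqrf_eq0 => /eqP e2.
  by apply/eqP; apply: (lin_eq (eqD (eqM b e3) (eqM (-a) e2))); rewrite /M /c3 /c2; ring.
(* N - t D is to be c3 (x - w) ^ 3, whose coefficient of x ^ 2 is c2. *)
set w := - c2 / (3 * c3).
have hw : c2 = - 3 * c3 * w by rewrite /w; field; rewrite n3 c30.
have Rw : w ^+ 2 + A * w + B = 0.
  have k0 : 9 * c3 ^+ 2 != 0.
    have -> : 9 * c3 ^+ 2 = (3 * c3) ^+ 2 by ring.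
    by rewrite expf_neq0 // mulf_neq0.
  apply: (mulfI k0); rewrite mulr0; move: hQ; rewrite hw => hQ.
  by apply: (lin_eq hQ); ring.
have sM : s M = B ^+ 2 * M by rewrite -hT /M !(rmorphB, rmorphM) /= !sK; ring.
have B0 : B != 0.
  apply: contraNneq M0 => e; move: sM; rewrite e expr0n mul0r => /eqP.
  by rewrite fmorph_eq0.
have sA : s A * B = A.
  apply: (mulIf M0); apply: (mulIf B0).
  have e : s (A * M) = A * B * M by rewrite -hL -hsL !(rmorphB, rmorphM) /= !sK; ring.
  move: e; rewrite rmorphM sM => e; apply: (lin_eq e); ring.
have w0 : w != 0.
  apply: contraNneq B0 => e; move: Rw; rewrite e => e'.
  by apply/eqP; apply: (lin_eq e'); ring.
have t0 := unitary_neq0 ut.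
have sc3 : t * s c3 = c3 * w ^+ 3.
  have -> : t * s c3 = t * d - s a.
    rewrite /c3 rmorphB rmorphM /= sK; apply: (lin_eq (eqM (- s a) ut)); ring.
  apply: (mulfI n3).
  have e1 : 3 * (t * d - s a) = 3 * c3 * A * B - c2 * (A ^+ 2 - B).
    apply: (lin_eq (eqD (eqM t hd) (eqM (-1) hd'))); rewrite /c3 /c2; ring.
  rewrite e1 hw; apply: (lin_eq (eqM (-3 * c3 * (w - A)) Rw)); ring.
have sc2 : t * s c2 = - 3 * c3 * w ^+ 2.
  have -> : t * s c2 = t * c - s b.
    rewrite /c2 rmorphB rmorphM /= sK; apply: (lin_eq (eqM (- s b) ut)); ring.
  have e1 : (t * c - s b) = 3 * c3 * B - c2 * A.
    apply: (lin_eq (eqD (eqM t hc) (eqM (-1) hc'))); rewrite /c3 /c2; ring.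
  rewrite e1 hw; apply: (lin_eq (eqM (3 * c3) Rw)); ring.
have s3 : s 3 = 3 by rewrite rmorph_nat.
have uw : unitary w.
  have k0 : t * s c3 * 3 != 0 by rewrite !mulf_neq0 // fmorph_eq0.
  apply: (mulIf k0); rewrite mul1r.
  have e : s c2 = - 3 * s c3 * s w by rewrite hw !(rmorphM, rmorphN) /= s3.
  move: sc2; rewrite e => sc2.
  apply: (lin_eq (eqD (eqM (-w) sc2) (eqM (-3) sc3))); ring.
pose v := - A - w.
have hA : A = - (w + v) by rewrite /v; ring.
have hB : B = w * v by apply: (lin_eq Rw); rewrite /v; ring.
have v0 : v != 0 by apply: contraNneq B0; rewrite hB => ->; rewrite mulr0.
have uv : unitary v.
  have sA' : s A = A / B by apply: (mulIf B0); rewrite sA mulfVK.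
  rewrite /unitary {2}/v rmorphB rmorphN /= (unitary_conj uw) sA' hA hB.
  by field; rewrite w0 v0.
have wv : w != v.
  apply/eqP => e; case/eqP: hpi; apply: (mulfI n3).
  rewrite h3p hA hB -e; ring.
clearbody w v.
move=> x y ux uy hxy; apply/eqP; rewrite -subr_eq0.
set X := (x - w) * (y - v); set Y := (x - v) * (y - w).
have dXY : Y - X = (v - w) * (x - y) by rewrite /X /Y; ring.
have fact : M * (x - y) * (X ^+ 2 + X * Y + Y ^+ 2) = 0.
  have e : 3 * M * (x - y) * (X ^+ 2 + X * Y + Y ^+ 2) = 0.
    have ed : d = (b * (A ^+ 2 - B) - 3 * a * A * B) / 3 by rewrite -hd; field.
    have ed' : s a = (s c * (A ^+ 2 - B) - 3 * s d * A * B) / 3.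
      by rewrite -hd'; field.
    have eM : M = b * s d - a * s c by [].
    move: hxy; rewrite hc' ed'.
    move: (s c) (s d) eM => n2 n3' eM; rewrite hc ed => hxy.
    apply: (lin_eq (eqM 9 hxy)); rewrite eM /cform /X /Y hA hB.
    by field.
  apply: (mulfI n3); rewrite mulr0; apply: (lin_eq e); ring.
move/eqP: fact; rewrite !mulf_eq0 (negPf M0) /= => /orP[//|/eqP fact].
have hcube : X ^+ 3 = Y ^+ 3 by apply: (lin_eq (eqM (X - Y) fact)); ring.
suff e : X = Y.
  have : (v - w) * (x - y) == 0 by rewrite -dXY e subrr.
  by rewrite mulf_eq0 (subr_eq0 v) [v == w]eq_sym (negPf wv).
have [Y0|Y0] := eqVneq Y 0.
  have : X ^+ 3 == 0 by rewrite hcube Y0 expr0n.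
  by rewrite expf_eq0 /= Y0 => /eqP.
have x0 := unitary_neq0 ux; have y0 := unitary_neq0 uy.
have q : X / Y = 1.
  apply: cub; last by rewrite expr_div_n hcube mulfV // expf_neq0.
  have sX : s X = X / (x * y * w * v).
    rewrite /X rmorphM !rmorphB /= (unitary_conj ux) (unitary_conj uy)
     (unitary_conj uv) (unitary_conj uw); field.
    by rewrite x0 w0 y0 v0.
  have sY : s Y = Y / (x * y * w * v).
    rewrite /Y rmorphM !rmorphB /= (unitary_conj ux) (unitary_conj uy)
     (unitary_conj uv) (unitary_conj uw); field.
    by rewrite x0 w0 y0 v0.
  by rewrite fmorph_div sX sY; field; rewrite x0 w0 y0 v0 Y0.
by apply: (mulIf (invr_neq0 Y0)); rewrite q mulfV.
Qed.
End Involution.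

(** * Total ramification *)

Section Ramification.
Variables (F : fieldType) (s : {rmorphism F -> F}).
Hypothesis sK : involutive s.

Definition nonvanishing (a b c d : F) :=
  forall x, unitary s x -> cform a b c d x 1 != 0.

(** N - t D is l times (x - u) ^ 3, coefficient by coefficient. *)
Definition totally_ramified (a b c d u t l : F) :=
  [/\ s d - t * a = l, s c - t * b = - 3 * l * u,
      s b - t * c = 3 * l * u ^+ 2 & s a - t * d = - l * u ^+ 3].

Lemma totally_ramifiedP a b c d u t l x : totally_ramified a b c d u t l ->
  cform (s d) (s c) (s b) (s a) x 1 = t * cform a b c d x 1 + l * (x - u) ^+ 3.
Proof.
case=> h3 h2 h1 h0.
apply: (lin_eq (eqD (eqD (eqM (x ^+ 3) h3) (eqM (x ^+ 2) h2)) (eqD (eqM x h1) h0))).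
rewrite /cform; ring.
Qed.

(** On mu, conjugation is inversion, so N is the reciprocal conjugate of D.  In
    particular g maps mu to itself. *)
Lemma cform_conj a b c d x : unitary s x ->
  cform (s d) (s c) (s b) (s a) x 1 = x ^+ 3 * s (cform a b c d x 1).
Proof.
move=> ux; have x0 := unitary_neq0 ux.
rewrite /cform !(rmorphD, rmorphM, rmorphXn, rmorph1) /= (unitary_conj ux).
by field.
Qed.

Lemma branch_value_unitary a b c d u t l : nonvanishing a b c d ->
  unitary s u -> totally_ramified a b c d u t l -> unitary s t.
Proof.
move=> nv uu tr; have := totally_ramifiedP u tr.
rewrite subrr expr0n mulr0 addr0 cform_conj // => e.
have := nv u uu; set z := cform _ _ _ _ _ _ in e * => z0.
have u0 := unitary_neq0 uu; have sz0 : s z != 0 by rewrite fmorph_eq0.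
have -> : t = u ^+ 3 * s z / z by apply: (mulIf z0); rewrite -e mulfVK.
rewrite /unitary !(rmorphM, rmorphXn, fmorphV) /= sK (unitary_conj uu).
by field; rewrite u0 z0 sz0.
Qed.

(** Otherwise g would be the constant t. *)
Lemma ramification_coef_neq0 a b c d u t l y : injective_on_unitary s a b c d ->
  unitary s u -> unitary s y -> u != y -> totally_ramified a b c d u t l -> l != 0.
Proof.
move=> inj uu uy uy' tr; apply: contraNneq uy' => l0; apply/eqP.
by apply: (inj _ _ uu uy); rewrite !(totally_ramifiedP _ tr) l0 !mul0r !addr0; ring.
Qed.

(** The minors of (N, D) are proportional to those of the basis (x - u) ^ 3,
    (x - v) ^ 3 of their span, for which A = - (u + v) and B = u v is a direct
    computation. *)
Lemma two_cubes_minors (a b c d u t l v t' l' : F) :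
  3 != 0 :> F -> injective_on_unitary s a b c d ->
  unitary s u -> unitary s v -> u != v ->
  totally_ramified a b c d u t l -> totally_ramified a b c d v t' l' ->
  let M := b * s d - a * s c in let A := - (u + v) in let B := u * v in
  [/\ M != 0, c * s d - a * s b = A * M, s c * d - s a * b = A * B * M,
      c * s c - b * s b + 3 * (d * s d - a * s a) = (A ^+ 2 + 2 * B) * M &
      s b * d - s a * c = B ^+ 2 * M].
Proof.
move=> n3 inj uu uv uv' tr tr' M A B.
have l0 := ramification_coef_neq0 inj uu uv uv' tr.
have uv'' : v != u by rewrite eq_sym.
have l0' := ramification_coef_neq0 inj uv uu uv'' tr'.
case: tr tr' => [h3 h2 h1 h0] [k3 k2 k1 k0].
have tt : t - t' != 0.
  rewrite subr_eq0; apply: contraNneq uv' => e; rewrite e in h3 h2.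
  have el : l = l' by rewrite -h3 -k3.
  apply/eqP; apply: (mulfI n3); apply: (mulfI l0).
  by rewrite el; apply: (lin_eq (eqD (eqM (-1) k2) h2)); rewrite el; ring.
have minor i j i' j' p p' r r' : i' - t * i = p -> j' - t * j = r ->
    i' - t' * i = p' -> j' - t' * j = r' ->
    (t - t') * (i' * j - j' * i) = p * r' - r * p'.
  by move=> <- <- <- <-; ring.
have eM : (t - t') * M = 3 * l * l' * (u - v).
  by apply: (lin_eq (minor _ _ _ _ _ _ _ _ h3 h2 k3 k2)); rewrite /M; ring.
split.
- have : (t - t') * M != 0 by rewrite eM !mulf_neq0 // subr_eq0.
  by rewrite mulf_eq0 negb_or => /andP[].
- apply: (mulfI tt); transitivity (A * ((t - t') * M)); last by ring.
  rewrite eM; apply: (lin_eq (minor _ _ _ _ _ _ _ _ h3 h1 k3 k1)); rewrite /A; ring.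
- apply: (mulfI tt); transitivity (A * B * ((t - t') * M)); last by ring.
  by rewrite eM; apply: (lin_eq (minor _ _ _ _ _ _ _ _ h2 h0 k2 k0)); rewrite /A /B; ring.
- apply: (mulfI tt); transitivity ((A ^+ 2 + 2 * B) * ((t - t') * M)); last by ring.
  rewrite eM; apply: (lin_eq (eqD (minor _ _ _ _ _ _ _ _ h2 h1 k2 k1)
    (eqM 3 (minor _ _ _ _ _ _ _ _ h3 h0 k3 k0)))); rewrite /A /B; ring.
- apply: (mulfI tt); transitivity (B ^+ 2 * ((t - t') * M)); last by ring.
  by rewrite eM; apply: (lin_eq (minor _ _ _ _ _ _ _ _ h1 h0 k1 k0)); rewrite /B; ring.
Qed.

Section Char3.
Hypothesis char3 : 3 = 0 :> F.

(** The variant of [lin_eq] for identities that hold modulo 3. *)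
Lemma lin_eq3 (x y l r k : F) : l = r -> x - y = l - r + 3 * k -> x = y.
Proof. by rewrite char3 mul0r addr0; apply: lin_eq. Qed.

(** The map x |-> 1 / (x - al) carries mu minus al bijectively to the affine line
    s z = - al - al ^ 2 z; this lemma and the next are the two directions. *)
Lemma line_unitary al sg : unitary s al -> s sg = - al - al ^+ 2 * sg ->
  sg != 0 /\ unitary s (al + sg^-1).
Proof.
move=> ua hs; have a0 := unitary_neq0 ua.
have sg0 : sg != 0.
  apply: contraTneq isT => e; move/eqP: hs.
  by rewrite e rmorph0 mulr0 subr0 eq_sym oppr_eq0 (negPf a0).
split=> //; have ss0 : - al - al ^+ 2 * sg != 0 by rewrite -hs fmorph_eq0.
rewrite /unitary rmorphD fmorphV hs (unitary_conj ua).
have h0 : 1 + al * sg != 0.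
  apply: contraNneq ss0 => e; apply/eqP; apply: (lin_eq (eqM (-al) e)); ring.
have -> : - al - al ^+ 2 * sg = - al * (1 + al * sg) by ring.
by field; rewrite h0 oppr_eq0 a0 sg0.
Qed.

Lemma unitary_line al x : unitary s al -> unitary s x -> x != al ->
  s (x - al)^-1 = - al - al ^+ 2 * (x - al)^-1.
Proof.
move=> ua ux xa; have a0 := unitary_neq0 ua; have x0 := unitary_neq0 ux.
have xa0 : x - al != 0 by rewrite subr_eq0.
rewrite fmorphV rmorphB /= (unitary_conj ua) (unitary_conj ux).
have ax0 : al - x != 0 by rewrite -opprB oppr_eq0.
by field; rewrite mulN1r ax0 xa0 x0 a0.
Qed.

(** In the coordinate z = 1 / (x - al) the function g is Moebius equivalent to
    e0 z ^ 3 + e1 z ^ 2 + b z, and two points of the line with sum S and difference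
    De have the same value when b + e1 S + e0 De ^ 2 = 0.  If e1 were not zero one
    could solve for S, whatever De is; so e1 = 0, which is c = al b, and no
    difference De of two points of the line satisfies b + e0 De ^ 2 = 0. *)
Lemma char3_shape a b c d al t l de :
  nonvanishing a b c d -> injective_on_unitary s a b c d ->
  unitary s al -> totally_ramified a b c d al t l ->
  de != 0 -> s de = - de -> (exists2 x, unitary s x & x != al) ->
  let e0 := cform a b c d al 1 in
  [/\ c = al * b, l != 0, s b = al * t * b
    & forall De, De != 0 -> s De = - al ^+ 2 * De -> b + e0 * De ^+ 2 != 0].
Proof.
move=> nv inj ua tr de0 sde [x1 ux1 x1a] e0.
have a0 := unitary_neq0 ua.
have l0 : l != 0.
  by apply: (ramification_coef_neq0 inj ua ux1 _ tr); rewrite eq_sym.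
have ut := branch_value_unitary nv ua tr.
have e00 : e0 != 0 := nv _ ua.
have trP x := totally_ramifiedP x tr.
have se0 : s e0 * al ^+ 3 = t * e0.
  have := trP al; rewrite cform_conj // subrr expr0n mulr0 addr0 mulrC => ->.
  by rewrite /e0.
case: (tr) => h3 h2 h1 h0.
have sc : s c = t * b by apply: (lin_eq3 (k := - l * al) h2); ring.
have sb : s b = t * c by apply: (lin_eq3 (k := l * al ^+ 2) h1); ring.
pose e1 := c - b * al.
have expand z : cform a b c d z 1 =
    a * (z - al) ^+ 3 + b * (z - al) ^+ 2 + e1 * (z - al) + e0.
  apply: (lin_eq3 (k := al * a * (z * (z - al)) - al * b * (al - z)) (erefl 0)).
  rewrite /e0 /e1 /cform; ring.
have fibre sg sg' : s sg = - al - al ^+ 2 * sg -> s sg' = - al - al ^+ 2 * sg' ->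
    b + e1 * (sg + sg') + e0 * (sg - sg') ^+ 2 = 0 -> sg = sg'.
  move=> hs hs' e.
  have [sg0 us] := line_unitary ua hs; have [sg0' us'] := line_unitary ua hs'.
  suff : al + sg^-1 = al + sg'^-1 by move/addrI/invr_inj.
  apply: inj => //; rewrite !trP.
  pose D x := cform a b c d x 1.
  have e' : (D (al + sg'^-1) - a * sg'^-1 ^+ 3) * sg^-1 ^+ 3
           = (D (al + sg^-1) - a * sg^-1 ^+ 3) * sg'^-1 ^+ 3.
    rewrite /D !expand ![al + _]addrC !addrK.
    apply: (lin_eq3 (k := - e0 * sg * sg' * (sg - sg') / (sg * sg') ^+ 3)
      (eqM ((sg' - sg) / (sg * sg') ^+ 3) e)).
    by field; rewrite sg0 sg0'.
  rewrite -/(D _) -/(D _) ![al + _ - al]addrC !addKr.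
  apply: (lin_eq (eqM l e')); ring.
have e10 : e1 = 0.
  apply/eqP; apply: contraT => e10.
  have se1 : s e1 = - t * e1 / al.
    rewrite /e1 rmorphB rmorphM /= sc sb (unitary_conj ua).
    by field; rewrite a0.
  (* De is the difference of two points of the line, and Sg is chosen so that the points
     with this sum and difference violate injectivity. *)
  pose De := de / al.
  have sDe : s De = - al ^+ 2 * De.
    rewrite /De fmorph_div sde (unitary_conj ua); field.
    by rewrite oner_eq0 a0.
  have De0 : De != 0 by rewrite mulf_neq0 ?invr_eq0.
  pose Sg := - (b + e0 * De ^+ 2) / e1.
  have t0 := unitary_neq0 ut.
  have sSg : s Sg = al - al ^+ 2 * Sg.
    have se0' : s e0 = t * e0 / al ^+ 3.
      by apply: (mulIf (expf_neq0 3 a0)); rewrite se0 mulfVK // expf_neq0.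
    have cE : c = e1 + b * al by rewrite /e1; ring.
    rewrite /Sg fmorph_div rmorphN rmorphD rmorphM rmorphXn /= sb se1 sDe se0' cE.
    by fld.
  have e : - (Sg + De) = - (Sg - De).
    apply: fibre.
  + by rewrite rmorphN rmorphD /= sSg sDe; ring.
  + by rewrite rmorphN rmorphB /= sSg sDe; ring.
  + apply: (lin_eq3 (k := e0 * De ^+ 2 - e1 * Sg) (erefl 0)).
    by rewrite /Sg; fld.
  apply: contraNT De0 => _; apply/eqP.
  by apply: (lin_eq3 (k := De) e); ring.
have hc : c = al * b by apply: (lin_eq e10); rewrite /e1; ring.
split=> //; first by rewrite sb hc; ring.
move=> De De0 sDe; apply/eqP => e.
have hl := unitary_line ua ux1 x1a.
have e' : (x1 - al)^-1 = (x1 - al)^-1 - De.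
  apply: (fibre _ _ hl); first by rewrite rmorphB /= hl sDe; ring.
  by apply: (lin_eq e); rewrite e10; ring.
by case/eqP: De0; apply: (lin_eq e'); ring.
Qed.

(** The converse of [char3_shape]: here [e0] stands for the value of D at al divided
    by b. *)
Lemma char3_injective a b c d al e0 :
  unitary s al -> b * s d != a * s c ->
  c = al * b -> s b = al * s c ->
  d + a * al ^+ 3 - al ^+ 2 * b = e0 * b ->
  s a + s d * al ^+ 3 - al ^+ 2 * s c = e0 * s c -> e0 != 0 ->
  (forall De, De != 0 -> s De = - al ^+ 2 * De -> 1 + e0 * De ^+ 2 != 0) ->
  injective_on_unitary s a b c d.
Proof.
move=> ua M0 hc hb hd ha e00 noDe x y ux uy hxy.
have hd' : d = e0 * b - a * al ^+ 3 + al ^+ 2 * b by rewrite -hd; ring.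
have ha' : s a = e0 * s c - s d * al ^+ 3 + al ^+ 2 * s c by rewrite -ha; ring.
pose E z := (z - al) ^+ 2 + e0.
have expand i j z : cform i j (al * j) (e0 * j - i * al ^+ 3 + al ^+ 2 * j) z 1 =
    i * (z - al) ^+ 3 + j * E z.
  apply: (lin_eq3 (k := al * i * (z * (z - al)) + al * j * z) (erefl 0)).
  by rewrite /E /cform; ring.
have key : (x - al) ^+ 3 * E y = (y - al) ^+ 3 * E x.
  have M0' : b * s d - a * s c != 0 by rewrite subr_eq0.
  apply: (mulfI M0'); move: hxy; rewrite ha' hb.
  move: (s d) (s c) => n3 n2; rewrite hc hd' !expand => hxy.
  by apply: (lin_eq hxy); ring.
have Eal : E al = e0 by rewrite /E subrr expr0n add0r.
have [xa|xa] := eqVneq x al.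
  move: key; rewrite xa Eal subrr expr0n /= mul0r => /esym/eqP.
  by rewrite mulf_eq0 (negPf e00) orbF expf_eq0 /= subr_eq0 => /eqP->.
have [ya|ya] := eqVneq y al.
  move: key; rewrite ya Eal subrr expr0n /= mul0r => /eqP.
  by rewrite mulf_eq0 (negPf e00) orbF expf_eq0 /= subr_eq0 => /eqP->.
have xa0 : x - al != 0 by rewrite subr_eq0.
have ya0 : y - al != 0 by rewrite subr_eq0.
suff : (x - al)^-1 = (y - al)^-1 by move/invr_inj/addIr.
apply/eqP; rewrite -subr_eq0; apply: contraT => De0.
have sDe : s ((x - al)^-1 - (y - al)^-1) = - al ^+ 2 * ((x - al)^-1 - (y - al)^-1).
  by rewrite rmorphB /= !unitary_line //; ring.
case/eqP: (noDe _ De0 sDe).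
apply: (mulfI De0); rewrite mulr0.
have k0 : (x - al) ^+ 3 * (y - al) ^+ 3 != 0 by rewrite mulf_neq0 ?expf_neq0.
apply: (mulfI k0); rewrite mulr0.
apply: (lin_eq3 (k := e0 * (x - y) * (x - al) * (y - al)) (eqM (-1) key)).
by rewrite /E; field; rewrite xa0 ya0.
Qed.

End Char3.
End Ramification.

(** * Sums over the roots of unity *)

Section Finite.
Variables (F : finFieldType) (s : {rmorphism F -> F}) (q : nat).
Hypothesis sK : involutive s.
Hypothesis sE : forall x, s x = x ^+ q.
Hypothesis q_gt1 : (1 < q)%N.
Hypothesis q0 : q%:R = 0 :> F.
Hypothesis hF : #|F| = (q ^ 2)%N.
Variable gamma : F.
Hypothesis hgamma : (q.+1).-primitive_root gamma.

Lemma unitaryE x : unitary s x <-> x ^+ q.+1 = 1.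
Proof. by rewrite /unitary sE exprS. Qed.

Lemma unitary1 : unitary s (1 : F).
Proof. by rewrite /unitary rmorph1 mulr1. Qed.

Lemma unitaryM x y : unitary s x -> unitary s y -> unitary s (x * y).
Proof. by rewrite /unitary rmorphM mulrACA => -> ->; rewrite mulr1. Qed.

Lemma unitaryV x : unitary s x -> unitary s x^-1.
Proof. by rewrite /unitary fmorphV -invfM => ->; rewrite invr1. Qed.

Lemma unitary_gamma : unitary s gamma.
Proof. by apply/unitaryE; exact: prim_expr_order. Qed.

Lemma gamma_neq1 : gamma != 1.
Proof. by rewrite -[gamma]expr1 -(prim_order_dvd hgamma) gtnNdvd // ltnS ltnW. Qed.

Definition mu : {set F} := [set x | x * s x == 1].

Lemma in_muP x : reflect (unitary s x) (x \in mu).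
Proof. by rewrite inE; exact: eqP. Qed.

Lemma mu_image : mu = [set gamma ^+ i | i : 'I_q.+1].
Proof.
apply/setP => x; apply/in_muP/imsetP => [/unitaryE ux | [i _ ->]].
  by have [i ->] := prim_rootP hgamma ux; exists i.
by apply/unitaryE; rewrite exprAC (prim_expr_order hgamma) expr1n.
Qed.

Lemma card_mu : #|mu| = q.+1.
Proof.
rewrite mu_image card_imset ?card_ord // => i j /eqP.
rewrite (eq_prim_root_expr hgamma) !modn_small // => /eqP; exact: val_inj.
Qed.

Lemma sum_mu_scale (f : F -> F) k : unitary s k ->
  \sum_(x in mu) f (k * x) = \sum_(x in mu) f x.
Proof.
move=> uk; rewrite [RHS](reindex_inj (mulfI (unitary_neq0 uk))) /=.
apply: eq_bigl => x; apply/in_muP/in_muP => ux; first exact: unitaryM.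
by rewrite -[x](mulKf (unitary_neq0 uk)); apply: unitaryM => //; apply: unitaryV.
Qed.

(** Multiplication by gamma permutes mu and multiplies the sum by gamma ^ j. *)
Lemma sum_mu_exp j : ~~ (q.+1 %| j)%N -> \sum_(x in mu) x ^+ j = 0.
Proof.
rewrite (prim_order_dvd hgamma) => gj.
have := sum_mu_scale (fun x => x ^+ j) unitary_gamma.
under eq_bigr do rewrite exprMn; rewrite -mulr_sumr => /eqP.
rewrite -subr_eq0 -{2}[\sum_(_ in _) _]mul1r -mulrBl mulf_eq0 subr_eq0 (negPf gj) /=.
by move/eqP.
Qed.

Lemma sum_mu_expV j : ~~ (q.+1 %| j)%N -> \sum_(x in mu) x^-1 ^+ j = 0.
Proof.
move=> hj; apply: etrans (sum_mu_exp hj); rewrite [RHS](reindex_inj invr_inj) /=.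
apply: eq_bigl => x; apply/in_muP/in_muP => ux; first exact: unitaryV.
by rewrite -[x]invrK; apply: unitaryV.
Qed.

Definition mu1 : {set F} := mu :\ 1.

Lemma sum_mu1 (f : F -> F) : \sum_(x in mu1) f x = \sum_(x in mu) f x - f 1.
Proof.
have m1 : 1 \in mu by apply/in_muP; exact: unitary1.
by rewrite [X in _ = X - _](big_setD1 1) //= addrAC subrr add0r.
Qed.

Lemma sum_mu1_exp j : ~~ (q.+1 %| j)%N -> \sum_(x in mu1) x ^+ j = -1.
Proof. by move=> hj; rewrite sum_mu1 sum_mu_exp // expr1n sub0r. Qed.

Lemma sum_mu1_expV j : ~~ (q.+1 %| j)%N -> \sum_(x in mu1) x^-1 ^+ j = -1.
Proof. by move=> hj; rewrite sum_mu1 sum_mu_expV // invr1 expr1n sub0r. Qed.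

Lemma sum_mu1_const k : \sum_(x in mu1) k = 0 :> F.
Proof.
rewrite sum_mu1 sumr_const card_mu mulrS -mulr_natr q0 mulr0 addr0 subrr //.
Qed.

(** Hilbert 90: X = y + s(x y) satisfies s X = x X, and it is not zero for y = 1 or for
    y = gamma. *)
Lemma hilbert90 x : unitary s x -> exists2 X, X != 0 & s X = x * X.
Proof.
move=> ux; have sx := unitary_conj ux; have x0 := unitary_neq0 ux.
pose X y := y + s x * s y.
have sX y : s (X y) = x * X y.
  by rewrite /X rmorphD rmorphM /= !sK sx mulrDr mulrA mulfV // mul1r addrC.
(* For y = 1 this fails only if x = - 1. *)
have [X1|] := eqVneq (X 1) 0; last by exists (X 1).
have sx1 : s x = -1.
  by move: X1; rewrite /X rmorph1 mulr1 => X1; apply: (lin_eq X1); ring.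
exists (X gamma) => //; rewrite /X sx1 mulN1r subr_eq0 unitary_conj; last exact: unitary_gamma.
apply/eqP => e; have g0 := unitary_neq0 unitary_gamma.
have : gamma ^+ 2 == 1 by rewrite expr2 {2}e mulfV.
by rewrite -(prim_order_dvd hgamma) gtnNdvd.
Qed.

Lemma conj_unit_power X : X != 0 -> unitary s (s X / X).
Proof.
by move=> X0; rewrite /unitary fmorph_div sK; have : s X != 0 by [rewrite fmorph_eq0]; move=> sX0; fld.
Qed.

(** A power of a generator of the multiplicative group of F generates that of the
    fixed field. *)
Lemma fixed_generator : exists k : F, [/\ k != 0, s k = k &
  forall j, (0 < j < q.-1)%N -> k ^+ j != 1].
Proof.
pose rs := [seq x <- enum F | x != 0].
have szrs : size rs = (q ^ 2).-1.
  rewrite -hF size_filter -(cardC1 (0 : F)) cardE size_filter.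
  by rewrite -enumT; apply: eq_count => x; rewrite !inE.
have n0 : (0 < (q ^ 2).-1)%N by move: q_gt1; lia.
have : has (q ^ 2).-1.-primitive_root rs.
  apply: has_prim_root => //; last by rewrite szrs.
    apply/allP => x; rewrite mem_filter => /andP[x0 _].
    apply/unity_rootP; apply: (mulfI x0).
    by rewrite -exprS prednK ?expn_gt0 ?(ltnW q_gt1) // -hF expf_card mulr1.
  by rewrite filter_uniq // enum_uniq.
case/hasP => th; rewrite mem_filter => /andP[th0 _] hth.
have fac : ((q ^ 2).-1 = q.+1 * q.-1)%N by move: q_gt1; nia.
exists (th ^+ q.+1); split; first by rewrite expf_neq0.
  rewrite sE -exprM.
  have -> : (q.+1 * q = (q ^ 2).-1 + q.+1)%N by move: q_gt1; nia.
  by rewrite exprD (prim_expr_order hth) mul1r.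
move=> j /andP[j0 jq]; rewrite -exprM -(prim_order_dvd hth) fac dvdn_pmul2l //.
by rewrite gtnNdvd.
Qed.

Definition line : {set F} := [set y | s y == - y].

(** Scaling by a generator of the fixed field permutes the line and does not fix the
    sum unless the latter is zero. *)
Lemma sum_line_exp j : (0 < j < q.-1)%N -> \sum_(y in line) y ^+ j = 0.
Proof.
have [k [k0 sk hk]] := fixed_generator => hj.
have e : \sum_(y in line) y ^+ j = k ^+ j * \sum_(y in line) y ^+ j.
  rewrite mulr_sumr [LHS](reindex_inj (mulfI k0)) /=.
  apply: eq_big => [y|y _]; last by rewrite exprMn.
  by rewrite !inE rmorphM sk -mulrN (inj_eq (mulfI k0)).
move/eqP: e; rewrite -subr_eq0 -{1}[\sum_(_ in _) _]mul1r -mulrBl mulf_eq0 subr_eq0.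
by rewrite eq_sym (negPf (hk j hj)) => /eqP.
Qed.

Variable om : F.
Hypothesis uom : unitary s om.
Hypothesis omE : om ^+ 2 + om + 1 = 0.

(** Both [om] and 1 / (x - 1), for x on mu, satisfy s z = - 1 - z, so their difference
    is anti-invariant.  A cube root of unity serves as such an origin in every
    characteristic; it is 1 in characteristic three. *)
Lemma conj_om : s om = - 1 - om.
Proof.
have o0 := unitary_neq0 uom; apply: (mulfI o0); rewrite uom.
by apply: (lin_eq omE); ring.
Qed.

Lemma sum_mu1_line (f : F -> F) :
  \sum_(x in mu1) f (x - 1)^-1 = \sum_(y in line) f (y + om).
Proof.
have line0 y : y \in line -> y + om != 0.
  rewrite inE => /eqP sy; apply/eqP => e.
  have := congr1 s e; rewrite rmorphD rmorph0 sy conj_om => e'.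
  case/eqP: (oner_neq0 F); apply: (lin_eq (eqM (-1) (eqD e e'))); ring.
rewrite (reindex_onto (fun y => 1 + (y + om)^-1) (fun x => (x - 1)^-1 - om)) /=; last first.
  by move=> x _; rewrite subrK invrK addrC subrK.
apply: eq_big => [y|y].
  apply/andP/idP => [[]|hy].
    rewrite !inE => /andP[y1 /eqP uy] /eqP ey; move: uy.
    have y0 : y + om != 0.
      by apply: contraNneq y1 => ->; rewrite invr0 addr0.
    have sy0 : s (y + om) != 0 by rewrite fmorph_eq0.
    rewrite rmorphD rmorph1 fmorphV => e.
    have e' : y + om + s (y + om) + 1 = 0.
      have k0 : (y + om)^-1 * (s (y + om))^-1 != 0 by rewrite mulf_neq0 ?invr_eq0.
      apply: (mulfI k0); rewrite mulr0; apply: (lin_eq e).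
      move: (s (y + om)) sy0 {e k0} => w w0; move: (y + om) y0 => z z0.
      by fld.
    move: e'; rewrite rmorphD conj_om => e'.
    by apply/eqP; apply: (lin_eq e'); ring.
  have y0 := line0 _ hy; move: hy; rewrite inE => /eqP hy.
  rewrite addrAC subrr add0r invrK addrK eqxx !inE; split=> //.
  have sy0 : s (y + om) != 0 by rewrite fmorph_eq0.
  rewrite -subr_eq0 addrAC subrr add0r invr_eq0 y0 /=; apply/eqP.
  rewrite rmorphD rmorph1 fmorphV; move: sy0; rewrite rmorphD hy conj_om => sy0.
  have -> : - y + (-1 - om) = - (y + om + 1) by ring.
  have h1 : y + om + 1 != 0.
    by apply: contraNneq sy0 => e; apply/eqP; apply: (lin_eq (eqM (-1) e)); ring.
  by fld.
by rewrite addrAC subrr add0r invrK.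
Qed.

Lemma sum_line_const k : \sum_(y in line) k = 0 :> F.
Proof. by rewrite -(sum_mu1_line (fun _ => k)) sum_mu1_const. Qed.

(** The power sums of 1 / (x - 1) over mu minus 1 vanish up to exponent q - 2; the
    three that are needed are stated separately. *)
Lemma moment1 : (2 < q)%N -> \sum_(x in mu1) (x - 1)^-1 = 0.
Proof.
move=> hq; rewrite (sum_mu1_line id) big_split /= sum_line_const addr0.
apply: etrans (@sum_line_exp 1 _); last by lia.
by apply: eq_bigr => y _; rewrite expr1.
Qed.

Lemma moment2 : (3 < q)%N -> \sum_(x in mu1) (x - 1)^-1 ^+ 2 = 0.
Proof.
move=> hq; rewrite (sum_mu1_line (fun z => z ^+ 2)).
have e y : (y + om) ^+ 2 = y ^+ 2 + y ^+ 1 * (2 * om) + om ^+ 2 by ring.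
under eq_bigr do rewrite e.
rewrite !big_split /= -!mulr_suml sum_line_const !sum_line_exp; try lia.
by rewrite !mul0r !addr0.
Qed.

Lemma moment3 : (4 < q)%N -> \sum_(x in mu1) (x - 1)^-1 ^+ 3 = 0.
Proof.
move=> hq; rewrite (sum_mu1_line (fun z => z ^+ 3)).
have e y : (y + om) ^+ 3 = y ^+ 3 + y ^+ 2 * (3 * om) + y ^+ 1 * (3 * om ^+ 2) + om ^+ 3.
  by ring.
under eq_bigr do rewrite e.
rewrite !big_split /= -!mulr_suml sum_line_const !sum_line_exp; try lia.
by rewrite !mul0r !addr0.
Qed.


(** In this section g(1) = t and the other two points of the fibre over t are 0 and
    infinity, that is, N - t D = lam (x ^ 2 - x). *)
Section Normalized.
Variables (a b c d t lam : F).
Hypothesis nv : nonvanishing s a b c d.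
Hypothesis inj : injective_on_unitary s a b c d.
Hypotheses (ut : unitary s t) (lam0 : lam != 0) (a0 : a != 0).
Hypotheses (hd : s d = t * a) (hc : s c = t * b + lam).
Hypotheses (hb : s b = t * c - lam) (ha : s a = t * d).

Let D x := cform a b c d x 1.
Let N x := cform (s d) (s c) (s b) (s a) x 1.
Let e := a + b + c + d.
Let G x := a * x + (a + b) - d * x^-1 + e * (x - 1)^-1.

Let NE x : N x = t * D x + lam * (x * (x - 1)).
Proof. by rewrite /N /D hd hc hb ha /cform; ring. Qed.

Let D1 : D 1 = e.
Proof. by rewrite /D /e /cform; ring. Qed.

Let e0 : e != 0.
Proof. by rewrite -D1; apply: nv; apply: unitary1. Qed.

(** G is lam / (g - t), and x |-> g(x) / t is a permutation of mu minus 1. *)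
Lemma normalized_power_sum k :
  \sum_(x in mu1) G x ^+ k = (lam / t) ^+ k * \sum_(x in mu1) (x - 1)^-1 ^+ k.
Proof.
have t0 := unitary_neq0 ut.
pose phi x := N x / D x / t.
have mu1P x : x \in mu1 -> [/\ unitary s x, x != 1, D x != 0 & x - 1 != 0].
  rewrite in_setD1 => /andP[x1 /in_muP ux]; split=> //; first exact: nv.
  by rewrite subr_eq0.
have phiG x : x \in mu1 -> G x = lam / t * (phi x - 1)^-1.
  move=> /mu1P[ux x1 Dx0 x10]; have x0 := unitary_neq0 ux.
  have dphi : phi x - 1 = lam * (x * (x - 1)) / (t * D x).
    by rewrite /phi NE; fld.
  have hG : G x = D x / (x * (x - 1)).
    by rewrite /G /D /e /cform; fld.
  rewrite hG dphi; move: (D x) Dx0 => z z0.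
  by fld.
have phi_inj : {in mu1 &, injective phi}.
  move=> x y /mu1P[ux x1 Dx0 _] /mu1P[uy y1 Dy0 _] exy.
  apply: (inj ux uy); rewrite -!/(N _) -!/(D _).
  have : N x / D x = N y / D y by apply: (mulIf (invr_neq0 t0)).
  move/(congr1 (fun z => z * (D x * D y))).
  have -> : N x / D x * (D x * D y) = N x * D y by field.
  have -> // : N y / D y * (D x * D y) = N y * D x by field.
have phi_mu : [set phi x | x in mu1] = mu1.
  apply/eqP; rewrite eqEcard card_in_imset // leqnn andbT.
  apply/subsetP => _ /imsetP[x hx ->]; have [ux x1 Dx0 x10] := mu1P _ hx.
  have x0 := unitary_neq0 ux.
  rewrite in_setD1; apply/andP; split.
    rewrite -subr_eq0; have -> : phi x - 1 = lam * (x * (x - 1)) / (t * D x).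
      by rewrite /phi NE; field; rewrite t0 Dx0.
    by rewrite mulf_neq0 ?invr_eq0 ?mulf_neq0.
  apply/in_muP; rewrite /phi; apply: unitaryM; last exact: unitaryV.
  have sD0 : s (D x) != 0 by rewrite fmorph_eq0.
  rewrite /N cform_conj // -/(D x).
  rewrite -mulrA; apply: unitaryM; last exact: conj_unit_power.
  by rewrite !exprS expr0 mulr1; do 2![apply: unitaryM => //].
rewrite -{2}phi_mu big_imset //= mulr_sumr.
by apply: eq_bigr => x hx; rewrite phiG // exprMn.
Qed.


(** Monomials x ^ j and x ^ - j with 0 < j < q + 1 sum to - 1 over mu minus 1 and
    constants sum to q = 0, so only the poles at 1 contribute otherwise.  The
    products of x, 1 / x and 1 / (x - 1) in powers of G are brought to this shape by
    partial fractions. *)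
Lemma laurent_sum (k1 k2 k3 l1 l2 l3 m1 m2 m3 n : F) : (2 < q)%N ->
  \sum_(x in mu1) (k1 * x ^+ 1 + k2 * x ^+ 2 + k3 * x ^+ 3
     + (l1 * x^-1 ^+ 1 + l2 * x^-1 ^+ 2 + l3 * x^-1 ^+ 3)
     + (m1 * (x - 1)^-1 + m2 * (x - 1)^-1 ^+ 2 + m3 * (x - 1)^-1 ^+ 3) + n)
  = - (k1 + k2 + k3 + l1 + l2 + l3) + m1 * (\sum_(x in mu1) (x - 1)^-1)
   + m2 * (\sum_(x in mu1) (x - 1)^-1 ^+ 2) + m3 * (\sum_(x in mu1) (x - 1)^-1 ^+ 3).
Proof.
move=> hq; rewrite !big_split /= -!mulr_sumr sum_mu1_const !sum_mu1_exp ?sum_mu1_expV;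
  try by rewrite gtnNdvd //; lia.
ring.
Qed.

Lemma normalized_first_sum :
  d - a = (lam / t - e) * \sum_(x in mu1) (x - 1)^-1.
Proof.
have := normalized_power_sum 1.
under eq_bigr do rewrite expr1.
under [in RHS]eq_bigr do rewrite expr1.
rewrite /G !big_split /= !sum_mu1_const sumrN -!mulr_sumr.
have -> : \sum_(x in mu1) x = -1.
  apply: etrans (@sum_mu1_exp 1 _); last by rewrite gtnNdvd // ltnS ltnW.
  by apply: eq_bigr => x _; rewrite expr1.
have -> : \sum_(x in mu1) x^-1 = -1.
  apply: etrans (@sum_mu1_expV 1 _); last by rewrite gtnNdvd // ltnS ltnW.
  by apply: eq_bigr => x _; rewrite expr1.
by rewrite expr1 => h; apply: (lin_eq h); ring.
Qed.

Let mu1_neq x : x \in mu1 -> x != 0 /\ x - 1 != 0.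
Proof.
rewrite in_setD1 subr_eq0 => /andP[x1 /in_muP ux]; split=> //.
exact: unitary_neq0 ux.
Qed.

Lemma normalized_second_sum : (2 < q)%N -> d = a ->
  - 2 * a * (a + e) = ((lam / t) ^+ 2 - e ^+ 2) * (\sum_(x in mu1) (x - 1)^-1 ^+ 2)
    - 2 * (a + b) * e * (\sum_(x in mu1) (x - 1)^-1).
Proof.
move=> hq da; have := normalized_power_sum 2.
pose c0 := a + b.
rewrite (eq_bigr (fun x => (2 * c0 * a) * x ^+ 1 + a ^+ 2 * x ^+ 2 + 0 * x ^+ 3
     + ((2 * a * e - 2 * c0 * a) * x^-1 ^+ 1 + a ^+ 2 * x^-1 ^+ 2 + 0 * x^-1 ^+ 3)
     + (2 * c0 * e * (x - 1)^-1 + e ^+ 2 * (x - 1)^-1 ^+ 2 + 0 * (x - 1)^-1 ^+ 3)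
     + (c0 ^+ 2 - 2 * a ^+ 2 + 2 * a * e))); last first.
  by move=> x /mu1_neq[x0 x1]; rewrite /G da -/c0; fld.
rewrite laurent_sum // => h; apply: (lin_eq h); rewrite /c0; ring.
Qed.

Lemma normalized_third_sum : (4 < q)%N -> d = a -> 3 * a * (a + e) * (e - 2 * (a + b)) = 0.
Proof.
move=> hq da; have := normalized_power_sum 3.
pose c0 := a + b.
rewrite (eq_bigr (fun x => (- 3 * a ^+ 3 + 3 * a * c0 ^+ 2 + 3 * a ^+ 2 * e) * x ^+ 1
     + (3 * a ^+ 2 * c0) * x ^+ 2 + a ^+ 3 * x ^+ 3
     + ((3 * a ^+ 3 - 3 * a * c0 ^+ 2 - 3 * a ^+ 2 * e + 6 * a * c0 * e - 3 * a * e ^+ 2) * x^-1 ^+ 1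
     + (3 * a ^+ 2 * c0 - 3 * a ^+ 2 * e) * x^-1 ^+ 2 + (- a ^+ 3) * x^-1 ^+ 3)
     + ((3 * c0 ^+ 2 * e + 6 * a * e ^+ 2) * (x - 1)^-1
        + 3 * c0 * e ^+ 2 * (x - 1)^-1 ^+ 2 + e ^+ 3 * (x - 1)^-1 ^+ 3)
     + (- 6 * a ^+ 2 * c0 + c0 ^+ 3 + 3 * a ^+ 2 * e + 6 * a * c0 * e))); last first.
  by move=> x /mu1_neq[x0 x1]; rewrite /G da -/c0; fld.
rewrite laurent_sum ?moment1 ?moment2 ?moment3 //; try lia.
by move=> h; apply: (lin_eq h); rewrite /c0; ring.
Qed.

(** For large q the moments vanish and the power sums are equations in a and e.  For
    q = 2 and q = 3 some moment is not zero, but the conjugation relations for e and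
    lam make its coefficient vanish. *)
Lemma normalized_coefs : gcdn 3 (q - 1) = 1%N -> d = a /\ e = - a.
Proof.
move=> hg; have t0 := unitary_neq0 ut.
have se : s e = t * e.
  by rewrite /e !rmorphD /= ha hb hc hd; ring.
have slam : s lam = lam / t.
  have h := congr1 s hc; rewrite sK rmorphD rmorphM /= hb (unitary_conj ut) in h.
  by apply: (lin_eq (eqM (-1) h)); fld.
have [q2|q2] := leqP q 2.
  (* mu has three points and a, e, t are nonzero with a ^ 2 = t d and e ^ 2 = t e. *)
  have {}q2 : q = 2%N by apply/eqP; rewrite eqn_leq q2.
  have two : 2 = 0 :> F by rewrite -q0 q2.
  have et : e = t by apply: (mulIf e0); rewrite -se sE q2 expr2.
  have sa : a = t.
    have t3 : t ^+ 3 = 1 by have /unitaryE := ut; rewrite q2.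
    have lt : lam / t = t.
      have l1 : lam = t^-1.
        by apply: (mulIf lam0); rewrite [RHS]mulrC -slam sE q2 expr2.
      by rewrite l1; apply: (mulIf (expf_neq0 2 t0)); rewrite -exprS t3; fld.
    have da : d = a.
      by apply/eqP; rewrite -subr_eq0 normalized_first_sum lt et subrr mul0r.
    by move: ha; rewrite da sE q2 expr2 => /(mulIf a0).
  have da : d = a.
    by move: ha; rewrite sa sE q2 expr2 => /(mulfI t0).
  split=> //; rewrite et sa; apply: (lin_eq (eqM t two)); ring.
have da : d = a.
  by apply/eqP; rewrite -subr_eq0 normalized_first_sum moment1 ?mulr0.
split=> //.
suff : a + e = 0 by move=> h; apply: (lin_eq h); ring.
have [two|two] := eqVneq (2 : F) 0.
  have hq : (4 < q)%N.
    rewrite ltn_neqAle; apply/andP; split.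
      by apply: contraTneq isT => q4; move: hg; rewrite -q4.
    rewrite ltn_neqAle q2 andbT; apply: contraTneq isT => q3.
    by case/eqP: (oner_neq0 F); apply: (lin_eq (eqD q0 (eqM (-1) two))); rewrite -q3; ring.
  apply: (mulfI (mulf_neq0 a0 e0)); rewrite mulr0.
  apply: (lin_eq (eqD (normalized_third_sum hq da)
       (eqM (- a * (a + e) * (e - 3 * (a + b))) two))); ring.
apply: (mulfI (mulf_neq0 two a0)); rewrite mulr0.
have := normalized_second_sum q2 da; rewrite moment1 // mulr0 subr0.
have [q3|q3] := leqP q 3; last first.
  by rewrite moment2 // mulr0 => h; apply: (lin_eq (eqM (-1) h)); ring.
have {}q3 : q = 3%N by apply/eqP; rewrite eqn_leq q3.
(* For q = 3 the second moment is not zero, but its coefficient vanishes. *)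
have -> : (lam / t) ^+ 2 = e ^+ 2.
  have t4 : t ^+ 4 = 1 by have /unitaryE := ut; rewrite q3.
  have -> : e ^+ 2 = t by apply: (mulIf e0); rewrite -exprSr -se sE q3.
  have l2 : lam ^+ 2 = t^-1.
    by apply: (mulIf lam0); rewrite -exprSr -[LHS]/(lam ^+ 3) -q3 -sE slam mulrC.
  rewrite expr_div_n l2; apply: (mulIf (expf_neq0 3 t0)).
  by rewrite -exprS t4; fld.
by rewrite subrr mul0r => h; apply: (lin_eq (eqM (-1) h)); ring.
Qed.

End Normalized.

(** Four points of the projective line over F suffice, and 0, infinity, 1 and gamma
    are distinct. *)
Lemma cform_ext (a b c d a' b' c' d' : F) :
  (forall u v, cform a b c d u v = cform a' b' c' d' u v) ->
  [/\ a = a', b = b', c = c' & d = d'].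
Proof.
move=> h; have ea : a = a' by apply: (lin_eq (h 1 0)); rewrite /cform; ring.
have ed : d = d' by apply: (lin_eq (h 0 1)); rewrite /cform; ring.
have e1 : b + c = b' + c'.
  by apply: (lin_eq (h 1 1)); rewrite /cform ea ed; ring.
have eb : b = b'.
  have k0 : gamma * (gamma - 1) != 0.
    by rewrite mulf_neq0 ?subr_eq0 ?gamma_neq1 ?(unitary_neq0 unitary_gamma).
  apply: (mulfI k0); apply: (lin_eq (eqD (h gamma 1) (eqM (- gamma) e1))).
  by rewrite /cform ea ed; ring.
by split=> //; apply: (lin_eq e1); rewrite eb; ring.
Qed.

Lemma cform_subst (a b c d P Q R S : F) : exists a' b' c' d', forall u v,
  cform a' b' c' d' u v = cform a b c d (P * u + Q * v) (R * u + S * v).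
Proof.
exists (cform a b c d P R).
exists (3 * a * P ^+ 2 * Q + b * (P ^+ 2 * S + 2 * P * Q * R)
  + c * (2 * P * R * S + Q * R ^+ 2) + 3 * d * R ^+ 2 * S).
exists (3 * a * P * Q ^+ 2 + b * (2 * P * Q * S + Q ^+ 2 * R)
  + c * (P * S ^+ 2 + 2 * Q * R * S) + 3 * d * R * S ^+ 2).
exists (cform a b c d Q S).
by move=> u v; rewrite /cform; ring.
Qed.

Lemma cform_swap (a b c d u v : F) :
  cform (s d) (s c) (s b) (s a) u v = s (cform a b c d (s v) (s u)).
Proof. by rewrite /cform !(rmorphD, rmorphM, rmorphXn) /= !sK; ring. Qed.

Lemma cform_hom (a b c d u v : F) : v != 0 ->
  cform a b c d u v = v ^+ 3 * cform a b c d (u / v) 1.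
Proof. by move=> v0; rewrite /cform; fld. Qed.

(** In this section X |-> ep X + z s(ep) s(X) is read on x = s(X) / X, where it is
    the Moebius map [blaschke] that preserves mu and sends 0 to z. *)
Section Blaschke.
Variables (z ep : F).
Hypotheses (z_mod : z * s z != 1) (ep0 : ep != 0).

Let num u v := ep * u + z * s ep * v.
Let den u v := s z * ep * u + s ep * v.
Definition blaschke xi := num xi 1 / den xi 1.

Let w0 : 1 - z * s z != 0.
Proof. by rewrite subr_eq0 eq_sym. Qed.
Let sep0 : s ep != 0.
Proof. by rewrite fmorph_eq0. Qed.

Let conj_den u v : s (den u v) = num (s v) (s u).
Proof. by rewrite /den /num !(rmorphD, rmorphM) /= !sK; ring. Qed.

Let den_neq0 xi : unitary s xi -> den xi 1 != 0.
Proof.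
move=> ux; have x0 := unitary_neq0 ux; apply: contraNneq z_mod => h.
have h' := congr1 s h; move: h'; rewrite conj_den rmorph0 /num rmorph1 (unitary_conj ux) => h'.
apply/eqP; apply: (mulIf sep0).
have e2 : ep + z * s ep * xi^-1 = 0 by apply: (lin_eq h'); ring.
apply: (lin_eq (eqD (eqM (s z * xi) e2) (eqM (-1) h))).
by rewrite /den; fld.
Qed.

Lemma blaschke_unitary xi : unitary s xi -> unitary s (blaschke xi).
Proof.
move=> ux; have x0 := unitary_neq0 ux; have dn := den_neq0 ux.
have e : num xi 1 = xi * s (den xi 1).
  by rewrite conj_den /num rmorph1 (unitary_conj ux); fld.
rewrite /blaschke e -mulrA; apply: unitaryM => //; exact: conj_unit_power.
Qed.

Lemma blaschke_inj xi et : unitary s xi -> unitary s et -> blaschke xi = blaschke et -> xi = et.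
Proof.
move=> ux ue; have dx := den_neq0 ux; have de := den_neq0 ue => h.
have k0 : ep * s ep * (1 - z * s z) != 0 by rewrite !mulf_neq0.
apply: (mulfI k0).
have h' : num xi 1 * den et 1 = num et 1 * den xi 1.
  have := congr1 (fun y => y * (den xi 1 * den et 1)) h; rewrite /blaschke => h'.
  by apply: (lin_eq h'); field; rewrite dx de.
by apply: (lin_eq h'); rewrite /num /den; ring.
Qed.

Variables (a b c d a' b' c' d' : F).
Hypothesis subst : forall u v, cform a' b' c' d' u v = cform a b c d (num u v) (den u v).

Lemma subst_conj u v : cform (s d') (s c') (s b') (s a') u v =
  cform (s d) (s c) (s b) (s a) (num u v) (den u v).
Proof.
rewrite !cform_swap subst conj_den.
have -> : s (num u v) = den (s v) (s u).
  by rewrite -[den _ _]sK conj_den !sK.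
by [].
Qed.

Lemma subst_nonvanishing : nonvanishing s a b c d -> nonvanishing s a' b' c' d'.
Proof.
move=> nv xi ux; rewrite subst cform_hom ?den_neq0 // mulf_neq0 ?expf_neq0 ?den_neq0 //.
by apply: nv; apply: blaschke_unitary.
Qed.

Lemma subst_injective : injective_on_unitary s a b c d -> injective_on_unitary s a' b' c' d'.
Proof.
move=> inj xi et ux ue; rewrite !subst_conj !subst => h.
have dx := den_neq0 ux; have de := den_neq0 ue.
apply: blaschke_inj => //; apply: inj; try exact: blaschke_unitary.
have k0 : den xi 1 ^+ 3 * den et 1 ^+ 3 != 0 by rewrite mulf_neq0 ?expf_neq0.
apply: (mulfI k0); move: h; rewrite !(cform_hom _ _ _ _ _ dx) !(cform_hom _ _ _ _ _ de).
by move=> h; apply: (lin_eq h); rewrite /blaschke; ring.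
Qed.

(** The linear form x - rh pulls back to a multiple of x - [blaschke rh], because the
    map has determinant ep s(ep) (1 - z s(z)). *)
Lemma subst_ramified rh t l : unitary s rh ->
  totally_ramified s a' b' c' d' rh t l ->
  exists l', totally_ramified s a b c d (blaschke rh) t l'.
Proof.
move=> ur [h3 h2 h1 h0].
have dr := den_neq0 ur.
pose K := ep * s ep * (1 - z * s z).
exists (l * (den rh 1 / K) ^+ 3).
have key U V : cform (s d) (s c) (s b) (s a) U V - t * cform a b c d U V =
    l * (den rh 1 / K) ^+ 3 * (U - blaschke rh * V) ^+ 3.
  pose u := (U - z * V) / (ep * (1 - z * s z)).
  pose v := (V - s z * U) / (s ep * (1 - z * s z)).
  have eU : U = num u v by rewrite /num /u /v; fld.
  have eV : V = den u v by rewrite /den /u /v; fld.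
  have e : cform (s d') (s c') (s b') (s a') u v - t * cform a' b' c' d' u v =
      l * (u - rh * v) ^+ 3.
    apply: (lin_eq (eqD (eqD (eqM (u ^+ 3) h3) (eqM (u ^+ 2 * v) h2))
       (eqD (eqM (u * v ^+ 2) h1) (eqM (v ^+ 3) h0)))).
    by rewrite /cform; ring.
  rewrite [in LHS]eU [in LHS]eV -subst_conj -subst e -mulrA -exprMn; congr (_ * _ ^+ 3).
  rewrite /blaschke /K /u /v; move: dr; rewrite /num /den mulr1 => dr.
  by field; rewrite dr ep0 sep0 w0.
set l' := l * _ in key *; set rr := blaschke rh in key *.
have := @cform_ext (s d - t * a) (s c - t * b) (s b - t * c) (s a - t * d)
  l' (- 3 * l' * rr) (3 * l' * rr ^+ 2) (- l' * rr ^+ 3).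
case; last by split.
move=> U V; apply: (lin_eq (key U V)); rewrite /cform; ring.
Qed.

End Blaschke.


Variables (p m : nat).
Hypotheses (pcharFp : p \in [pchar F]) (q_pow : q = (p ^ m)%N).

(** If the polynomial had no root in F, it would have one in a quadratic extension.
    There x |-> x ^ - q permutes the two roots, so its square x |-> x ^ (q ^ 2) fixes
    them, and they are in F after all. *)
Lemma conj_quadratic_root (r2 r1 r0 k : F) : r2 != 0 -> unitary s k ->
  s r2 = k * r0 -> s r1 = k * r1 -> exists z, r2 * z ^+ 2 + r1 * z + r0 = 0.
Proof.
move=> r20 uk s2 s1; have k0 := unitary_neq0 uk.
have s0 : s r0 = k * r2.
  apply: (mulfI k0); have := congr1 s s2; rewrite sK rmorphM (unitary_conj uk) => ->.
  by fld.
have r00 : r0 != 0.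
  by apply: contraNneq r20 => e; move/eqP: s0; rewrite e rmorph0 eq_sym mulf_eq0 (negPf k0).
pose P : {poly F} := r2 *: 'X^2 + r1 *: 'X + r0%:P.
have PE x : P.[x] = r2 * x ^+ 2 + r1 * x + r0 by rewrite /P !hornerE.
have szP : size P = 3%N.
  rewrite /P -addrA size_polyDl size_scale ?size_polyXn //.
  rewrite (leq_ltn_trans (size_polyD _ _)) // gtn_max.
  rewrite (leq_ltn_trans (size_scale_leq _ _)) ?size_polyX //.
  by rewrite (leq_ltn_trans (size_polyC_leq1 _)).
case: (pickP (root P)) => [z /rootP | noroot]; first by rewrite PE; exists z.
have irr : irreducible_poly P.
  by apply: cubic_irreducible => [|x]; rewrite ?szP // noroot.
have [L _ [z rz _]] := irredp_FAdjoin irr.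
have qnat : [pchar L].-nat q.
  rewrite q_pow (eq_pnat _ (pchar_lalg L)) pnatX.
  by rewrite (eq_pnat _ (pcharf_eq pcharFp)) /= pnat_id ?(pcharf_prime pcharFp).
pose io : {rmorphism F -> L} := GRing.in_alg L.
have ioq x : io x ^+ q = io (s x) by rewrite sE rmorphXn.
have quad x : root (map_poly io P) x <-> io r2 * x ^+ 2 + io r1 * x + io r0 = 0.
  by rewrite rootE /P !rmorphD /= !map_polyZ map_polyXn map_polyX map_polyC /= !hornerE; split=> /eqP.
have io0 x : x != 0 -> io x != 0 by rewrite fmorph_eq0.
(* the set of roots is stable under x |-> x ^- q *)
have step x : root (map_poly io P) x -> x != 0 /\ root (map_poly io P) (x ^- q).
  move/quad=> e; have x0 : x != 0.
    by apply: contraNneq (io0 _ r00) => x0; apply/eqP; apply: (lin_eq e); rewrite x0; ring.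
  split=> //; apply/quad.
  have := congr1 (fun y => y ^+ q) e.
  rewrite !(exprDn_pchar _ _ qnat) !exprMn !ioq s2 s1 s0 !rmorphM expr0n.
  have -> : (q == 0)%N = false by move: q_gt1; case: (q).
  move=> e'; have y0 : x ^+ q != 0 by rewrite expf_neq0.
  have ik0 := io0 _ k0; move: (x ^+ q) y0 e' => y y0 e'.
  apply: (mulfI ik0); apply: (mulfI (expf_neq0 2 y0)); rewrite !mulr0.
  by apply: (lin_eq e'); rewrite mulr0n; fld.
have two x y : root (map_poly io P) x -> root (map_poly io P) y ->
    y = x \/ y = - io r1 / io r2 - x.
  move=> /quad ex /quad ey; have i2 := io0 _ r20.
  have : (y - x) * (io r2 * (y + x) + io r1) = 0.
    by apply: (lin_eq (eqD ey (eqM (-1) ex))); ring.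
  move/eqP; rewrite mulf_eq0 subr_eq0 => /orP[/eqP|/eqP e]; first by left.
  by right; apply: (mulfI i2); apply: (lin_eq e); fld.
have [z0 rz1] := step z rz; have [z10 rz2] := step _ rz1.
have zz : (z ^- q) ^- q = z.
  case: (two _ _ rz rz1) => e1; first by rewrite !e1.
  case: (two _ _ rz rz2) => // e2.
  have e3 : (z ^- q) ^- q = z ^- q by rewrite e2 -e1.
  have e4 : (z ^- q) ^+ q = z ^+ q by apply: invr_inj.
  have : (z ^- q - z) ^+ q == 0.
    have := exprDn_pchar (z ^- q - z) z qnat; rewrite subrK e4 => e5.
    by apply/eqP/(addIr (z ^+ q)); rewrite -e5 add0r.
  by rewrite expf_eq0 subr_eq0 => /andP[_ /eqP e5]; rewrite !e5.
have zF : z ^+ #|F| - z = 0.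
  rewrite hF expnS expn1 exprM -{2}zz.
  by rewrite exprVn invrK subrr.
have := congr1 (fun Q => (map_poly io Q).[z]) (finField_genPoly F).
rewrite rmorphB /= map_polyXn map_polyX !hornerE zF rmorph_prod horner_prod => /esym/eqP.
rewrite prodf_seq_eq0 => /hasP[x _].
rewrite /= rmorphB /= map_polyX map_polyC !hornerE subr_eq0 => /eqP zx.
exists x; apply: (fmorph_inj io); rewrite rmorph0.
by move/quad: rz; rewrite zx !rmorphD !rmorphM.
Qed.

(**Over F, the zero set of a self-conjugate quadratic consists of points of mu or is
    a pair z, 1 / s(z) off mu. *)
Lemma conj_quadratic_split (r2 r1 r0 k : F) : unitary s k ->
  s r2 = k * r0 -> s r1 = k * r1 ->
  exists z, (unitary s z /\ r2 * z ^+ 2 + r1 * z + r0 = 0) \/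
    (z * s z != 1 /\ exists l, [/\ r2 = - l * s z, r1 = l * (1 + z * s z) & r0 = - l * z]).
Proof.
move=> uk s2 s1; have k0 := unitary_neq0 uk.
have s0 : s r0 = k * r2.
  apply: (mulfI k0); have := congr1 s s2; rewrite sK rmorphM (unitary_conj uk) => ->.
  by fld.
have [r20|r20] := eqVneq r2 0.
  exists 0; right; rewrite mul0r eq_sym oner_eq0; split=> //; exists r1.
  rewrite rmorph0 !mulr0 addr0 mulr1 r20; split=> //.
  by apply: (mulfI k0); rewrite -s2 r20 rmorph0 mulr0.
have [z ez] := conj_quadratic_root r20 uk s2 s1.
exists z; have [/eqP uz|uz] := boolP (z * s z == 1); [by left | right; split=> //].
have r00 : r0 != 0.
  by apply: contraNneq r20 => e; move/eqP: s0; rewrite e rmorph0 eq_sym mulf_eq0 (negPf k0).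
have z0 : z != 0.
  by apply: contraNneq r00 => e; apply/eqP; apply: (lin_eq ez); rewrite e; ring.
have sz0 : s z != 0 by rewrite fmorph_eq0.
have ez' : r0 * s z ^+ 2 + r1 * s z + r2 = 0.
  apply: (mulfI k0); have := congr1 s ez.
  by rewrite !(rmorphD, rmorphM, rmorphXn) rmorph0 /= s2 s1 s0 => h; apply: (lin_eq h); ring.
exists (- r2 / s z).
have dz : z * s z - 1 != 0 by rewrite subr_eq0.
have h1 : r1 = - r2 / s z * (1 + z * s z).
  apply: (mulfI dz); apply: (mulfI sz0).
  apply: (lin_eq (eqD (eqM (s z ^+ 2) ez) (eqM (-1) ez'))).
  by fld.
split=> //; first by fld.
apply: (lin_eq ez); rewrite h1; fld.
Qed.

(** The fibre of x0 is x0 together with the zeros of a self-conjugate quadratic.  By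
    injectivity the latter are off mu, unless x0 is totally ramified.  A Moebius map
    then brings g to the normal form of [normalized_coefs], in which the roots rh of
    x ^ 2 - x + 1 are totally ramified. *)
Lemma reduction_to_normal_form (a b c d x0 : F) : gcdn 3 (q - 1) = 1%N ->
  nonvanishing s a b c d -> injective_on_unitary s a b c d ->
  (forall z, cform a b c d z 1 = 0 -> cform (s d) (s c) (s b) (s a) z 1 <> 0) ->
  unitary s x0 -> (forall t l, ~ totally_ramified s a b c d x0 t l) ->
  exists2 phi : F -> F, forall x y, unitary s x -> unitary s y -> phi x = phi y -> x = y
   & forall rh, unitary s rh -> rh ^+ 2 - rh + 1 = 0 ->
     unitary s (phi rh) /\ exists t l, totally_ramified s a b c d (phi rh) t l.
Proof.
move=> hg nv inj cop u0 nr; have x00 := unitary_neq0 u0.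
pose D x := cform a b c d x 1; pose N x := cform (s d) (s c) (s b) (s a) x 1.
have D0 : D x0 != 0 := nv _ u0.
pose t := N x0 / D x0.
have ut : unitary s t.
  rewrite /t /N cform_conj // -/(D x0) -mulrA; apply: unitaryM; last exact: conj_unit_power.
  by rewrite !exprS expr0 mulr1; do 2![apply: unitaryM => //].
have t0 := unitary_neq0 ut.
have inj_t z : unitary s z -> N z = t * D z -> z = x0.
  move=> uz ez; apply: inj => //; rewrite -/(N z) -/(N x0) -/(D z) -/(D x0) ez /t.
  by fld.
pose r2 := s d - t * a; pose r1 := s c - t * b + r2 * x0; pose r0 := s b - t * c + r1 * x0.
have root0 : s a - t * d = - r0 * x0.
  have : N x0 - t * D x0 = 0 by rewrite /t; fld.
  rewrite /N /D /cform => e; apply: (lin_eq e); rewrite /r0 /r1 /r2; ring.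
clearbody t.
have CE z : N z - t * D z = (z - x0) * (r2 * z ^+ 2 + r1 * z + r0).
  by apply: (lin_eq root0); rewrite /N /D /cform /r0 /r1 /r2; ring.
have uk : unitary s (x0 / t) by apply: unitaryM => //; apply: unitaryV.
have st := unitary_conj ut; have sx0 := unitary_conj u0.
have s2 : s r2 = x0 / t * r0.
  have -> : s r2 = d - s a / t by rewrite /r2 rmorphB rmorphM /= sK st mulrC.
  by apply: (lin_eq (eqM (- t^-1) root0)); fld.
have s1 : s r1 = x0 / t * r1.
  have -> : s r1 = c - s b / t + x0 / t * r0 / x0.
    by rewrite /r1 rmorphD rmorphB !rmorphM /= sK st s2 sx0; ring.
  by rewrite /r0; fld.
have [z [[uz ez]|[zm [l [e2 e1 e0]]]]] := conj_quadratic_split uk s2 s1.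
  (* a point of mu in the fibre of x0 is x0 itself, hence x0 is a triple point *)
  have zx : z = x0.
    by apply: inj_t => //; apply/eqP; rewrite -subr_eq0 CE ez mulr0.
  subst z.
  have [r20|r20] := eqVneq r2 0.
    case: (nr t 0); have r00 : r0 = 0.
      by apply: (mulfI (unitary_neq0 uk)); rewrite -s2 r20 rmorph0 mulr0.
    have r10 : r1 = 0 by apply: (mulIf x00); apply: (lin_eq ez); rewrite r20 r00; ring.
    split.
    - exact: r20.
    - by apply: (lin_eq r10); rewrite /r1 r20; ring.
    - by apply: (lin_eq r00); rewrite /r0 r10; ring.
    - by rewrite root0 r00; ring.
  pose x1 := - r1 / r2 - x0.
  have sr2 : s r2 != 0 by rewrite fmorph_eq0.
  have r00 : r0 != 0.
    by apply: contraNneq sr2 => e; rewrite s2 e mulr0.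
  have x0x1 : x1 = r0 / r2 / x0.
    have i2 : r2 * x0 != 0 by rewrite mulf_neq0.
    by apply: (mulfI i2); apply: (lin_eq (eqM (-1) ez)); rewrite /x1; fld.
  have ux1 : unitary s x1.
    have : r0 / r2 / x0 = t / x0 / x0 * (s r2 / r2) by rewrite s2; fld.
    rewrite x0x1 => ->.
    by apply: unitaryM; [do ?[apply: unitaryM => //; try exact: unitaryV] | exact: conj_unit_power].
  have x1x : x1 = x0.
    apply: inj_t => //; apply/eqP; rewrite -subr_eq0 CE.
    have -> : r2 * x1 ^+ 2 + r1 * x1 + r0 = r2 * x0 ^+ 2 + r1 * x0 + r0.
      by rewrite /x1; fld.
    by rewrite ez mulr0.
  have h1 : r1 = - 2 * r2 * x0.
    by apply: (mulIf (invr_neq0 r20)); apply: (lin_eq (eqM (-1) x1x)); rewrite /x1; fld.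
  have h0 : r0 = r2 * x0 ^+ 2 by apply: (lin_eq ez); rewrite h1; ring.
  case: (nr t r2); split=> //.
  - by apply: (lin_eq h1); rewrite /r1; ring.
  - by apply: (lin_eq (eqD h0 (eqM (-x0) h1))); rewrite /r0; ring.
  - by rewrite root0 h0; ring.
have l0 : l != 0.
  apply/eqP => l0; rewrite l0 oppr0 !mul0r in e2 e1 e0.
  case: (nr t 0); split.
  - exact: e2.
  - by apply: (lin_eq e1); rewrite /r1 e2; ring.
  - by apply: (lin_eq e0); rewrite /r0 e1; ring.
  - by rewrite root0 e0; ring.
have Dz : D z != 0.
  apply/negP => /eqP e; apply: (cop z e).
  have := CE z; rewrite e e2 e1 e0 /N => h; apply: (lin_eq h); ring.
have [X0 X00 sX0] := hilbert90 u0.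
pose y := 1 - s z * x0.
have sy : s y = (x0 - z) / x0.
  by rewrite /y rmorphB rmorph1 rmorphM /= sK sx0; fld.
have y0 : y != 0.
  apply: contraNneq zm => e; move: sy; rewrite e rmorph0 => /esym/eqP.
  by rewrite mulf_eq0 invr_eq0 (negPf x00) orbF subr_eq0 => /eqP <-; apply/eqP.
have sy0 : s y != 0 by rewrite fmorph_eq0.
(* With this factor the substitution sends x0 to 1. *)
pose ep := s (y * X0).
have sep : s ep = y * X0 by rewrite /ep sK.
have epE : ep = s y * (x0 * X0) by rewrite /ep rmorphM sX0.
have ep0 : ep != 0 by rewrite epE !mulf_neq0.
have w0 : 1 - z * s z != 0 by rewrite subr_eq0 eq_sym.
have [a' [b' [c' [d' sub]]]] := cform_subst a b c d ep (z * s ep) (s z * ep) (s ep).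
pose lam := l * (ep * s ep * (1 - z * s z) ^+ 2) * (y * s y * (x0 * X0)).
have lam0 : lam != 0.
  by rewrite /lam sep ?mulf_neq0 ?expf_neq0.
have key u v : cform (s d') (s c') (s b') (s a') u v =
    cform (t * a') (t * b' + lam) (t * c' - lam) (t * d') u v.
  rewrite (subst_conj sub).
  have -> : cform (t * a') (t * b' + lam) (t * c' - lam) (t * d') u v =
    t * cform a' b' c' d' u v + lam * (u * v * (u - v)) by rewrite /cform; ring.
  rewrite sub.
  set U := ep * u + _; set V := s z * ep * u + _.
  have hU : U - x0 * V = (y * s y * (x0 * X0)) * (u - v).
    rewrite /U /V sep epE sy /y; fld.
  have hz : U - z * V = ep * (1 - z * s z) * u by rewrite /U /V; ring.
  have hz' : V - s z * U = s ep * (1 - z * s z) * v by rewrite /U /V; ring.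
  have : cform (s d) (s c) (s b) (s a) U V - t * cform a b c d U V =
     l * (U - x0 * V) * ((U - z * V) * (V - s z * U)).
    have h2 : s c - t * b = r1 - r2 * x0 by rewrite /r1; ring.
    have h3 : s b - t * c = r0 - r1 * x0 by rewrite /r0; ring.
    have h4 : s d - t * a = r2 by [].
    apply: (lin_eq (eqD (eqD (eqM (U ^+ 3) h4) (eqM (U ^+ 2 * V) h2))
       (eqD (eqM (U * V ^+ 2) h3) (eqM (V ^+ 3) root0)))).
    by rewrite e2 e1 e0 /cform; ring.
  rewrite hU hz hz' /lam => h; apply: (lin_eq h); ring.
have [hd' hc' hb' ha'] := cform_ext key.
have nv' := subst_nonvanishing zm ep0 sub nv.
have inj' := subst_injective zm ep0 sub inj.
have a'0 : a' != 0.
  have d'0 : d' != 0.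
    have : cform a' b' c' d' 0 1 = s ep ^+ 3 * D z by rewrite sub /D /cform; ring.
    have -> : cform a' b' c' d' 0 1 = d' by rewrite /cform; ring.
    by move=> ->; rewrite mulf_neq0 ?expf_neq0 // fmorph_eq0.
  by rewrite -(fmorph_eq0 s) ha' mulf_neq0.
have [da ea] := normalized_coefs nv' inj' ut lam0 a'0 hd' hc' hb' ha' hg.
exists (blaschke z ep) => [x x' ux ux'|rh ur rhE].
  exact: blaschke_inj.
split; first exact: blaschke_unitary.
have cE : c' = - 3 * a' - b' by apply: (lin_eq ea); rewrite da; ring.
have k0 : b' + 3 * rh * a' != 0.
  have := nv' _ ur; rewrite -oppr_eq0.
  have -> // : - cform a' b' c' d' rh 1 = b' + 3 * rh * a'.
  apply: (lin_eq (eqM (- a' * (rh + 1) - b') rhE)); rewrite /cform da cE; ring.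
pose k := b' + 3 * rh * a'.
(* (x - rh) ^ 3 = x ^ 3 - 3 x + 1 - 3 rh (x ^ 2 - x), and the normal form gives both
   terms as combinations of N and D. *)
pose t' := t + lam / k.
pose l' := - a' * lam / k.
have rh3 : rh ^+ 3 = -1 by apply: (lin_eq (eqM (rh + 1) rhE)); ring.
have rh2 : rh ^+ 2 = rh - 1 by apply: (lin_eq rhE); ring.
have tr : totally_ramified s a' b' c' d' rh t' l'.
  split; rewrite ?hd' ?hc' ?hb' ?ha' /t' /l' ?da ?cE ?rh3 ?rh2 /k; by fld.
have [l'' tr'] := subst_ramified zm ep0 sub ur tr.
by exists t', l''.
Qed.

Lemma totally_ramified_dec (a b c d u : F) :
  (exists t l, totally_ramified s a b c d u t l) \/
  (forall t l, ~ totally_ramified s a b c d u t l).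
Proof.
pose P := [exists t, exists l, [&& s d - t * a == l, s c - t * b == - 3 * l * u,
   s b - t * c == 3 * l * u ^+ 2 & s a - t * d == - l * u ^+ 3]].
have [/existsP[t /existsP[l /and4P[/eqP h1 /eqP h2 /eqP h3 /eqP h4]]]|no] := boolP P.
  by left; exists t, l.
right=> t l [/eqP h1 /eqP h2 /eqP h3 /eqP h4]; case/negP: no.
by apply/existsP; exists t; apply/existsP; exists l; apply/and4P.
Qed.

Section Existence.
Variables a b c d : F.
Hypothesis gcd3 : gcdn 3 (q - 1) = 1%N.
Hypothesis nv : nonvanishing s a b c d.
Hypothesis inj : injective_on_unitary s a b c d.
Hypothesis cop :
  forall z, cform a b c d z 1 = 0 -> cform (s d) (s c) (s b) (s a) z 1 <> 0.

Let root1 : unitary s (- om) /\ (- om) ^+ 2 - - om + 1 = 0.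
Proof.
split; first by rewrite /unitary rmorphN mulrNN.
by apply: (lin_eq omE); ring.
Qed.

Let root2 : unitary s (- om ^+ 2) /\ (- om ^+ 2) ^+ 2 - - om ^+ 2 + 1 = 0.
Proof.
have u2 : unitary s (om ^+ 2) by rewrite expr2; apply: unitaryM.
split; first by rewrite /unitary rmorphN mulrNN.
by apply: (lin_eq (eqM (om ^+ 2 - om + 1) omE)); ring.
Qed.

Lemma ramification_point_exists :
  exists u t l, unitary s u /\ totally_ramified s a b c d u t l.
Proof.
have [[t [l tr]]|no] := totally_ramified_dec a b c d 1.
  by exists 1, t, l; split=> //; exact: unitary1.
have [phi _ hphi] := reduction_to_normal_form gcd3 nv inj cop unitary1 no.
have [u1 e1] := root1; have [u2 [t [l tr]]] := hphi _ u1 e1.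
by exists (phi (- om)), t, l.
Qed.

(** Either 1 and gamma are both totally ramified, or one of them can serve as the
    base point x0 of the normal form.  The two roots of x ^ 2 - x + 1 are - om and
    - om ^ 2, which coincide only when 3 = 0. *)
Lemma two_ramification_points : 3 != 0 :> F -> exists u t l v t' l',
  [/\ unitary s u, unitary s v, u != v, totally_ramified s a b c d u t l
    & totally_ramified s a b c d v t' l'].
Proof.
move=> n3; have two x : unitary s x -> (forall t l, ~ totally_ramified s a b c d x t l) ->
    exists u t l v t' l', [/\ unitary s u, unitary s v, u != v,
      totally_ramified s a b c d u t l & totally_ramified s a b c d v t' l'].
  move=> ux no.
  have [phi phi_inj hphi] := reduction_to_normal_form gcd3 nv inj cop ux no.
  have [u1 e1] := root1; have [u2 e2] := root2.
  have [v1 [t [l tr]]] := hphi _ u1 e1; have [v2 [t' [l' tr']]] := hphi _ u2 e2.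
  exists (phi (- om)), t, l, (phi (- om ^+ 2)), t', l'; split=> //.
  apply: contraNneq n3 => /(phi_inj _ _ u1 u2) /oppr_inj e.
  have o0 := unitary_neq0 uom.
  have o1 : om = 1 by apply: (mulfI o0); rewrite mulr1 -expr2 -e.
  by apply/eqP; apply: (lin_eq omE); rewrite o1; ring.
have [[t [l tr]]|] := totally_ramified_dec a b c d 1; last exact: two unitary1.
have [[t' [l' tr']]|] := totally_ramified_dec a b c d gamma; last exact: two unitary_gamma.
exists 1, t, l, gamma, t', l'; split=> //; [exact: unitary1|exact: unitary_gamma|].
by rewrite eq_sym gamma_neq1.
Qed.
End Existence.

End Finite.

(** * From the polynomial h to the cubics D and N *)

(** A morphism structure on the q-th power map, obtained by iterating Frobenius. *)
Lemma frobenius_power (F : fieldType) (p m : nat) : p \in [pchar F] ->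
  exists s : {rmorphism F -> F}, forall x, s x = x ^+ (p ^ m).
Proof.
move=> pF; elim: m => [|m [s hs]]; first by exists idfun => x; rewrite expn0 expr1.
exists (pFrobenius_aut pF \o s) => x.
by rewrite /= pFrobenius_autE hs -exprM expnSr.
Qed.

Section Permutation.
Variables (F : finFieldType) (s : {rmorphism F -> F}) (q : nat).
Hypothesis sK : involutive s.
Hypothesis sE : forall x, s x = x ^+ q.
Hypothesis q_gt1 : (1 < q)%N.
Hypothesis hF : #|F| = (q ^ 2)%N.
Variable gamma : F.
Hypothesis hgamma : (q.+1).-primitive_root gamma.

Lemma fixed_exp (k : F) : k != 0 -> s k = k -> k ^+ (q - 1) = 1.
Proof.
move=> k0 sk; apply: (mulfI k0).
by rewrite -exprS mulr1 subn1 prednK ?(ltnW q_gt1) // -sE.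
Qed.

Lemma fixed_cube (k : F) : gcdn 3 (q - 1) = 1%N -> k != 0 -> s k = k ->
  (exists2 k', s k' = k' & k' ^+ 3 = k) /\ (k ^+ 3 = 1 -> k = 1).
Proof.
move=> hg k0 sk; have [n m' e _] := egcdnP (q - 1) (isT : (0 < 3)%N).
rewrite hg in e.
have kn : k ^+ (n * 3) = k.
  by rewrite e exprD mulnC exprM fixed_exp // expr1n mul1r.
split; last by move=> k3; rewrite -kn mulnC exprM k3 expr1n.
by exists (k ^+ n); rewrite -?exprM // rmorphXn /= sk.
Qed.

Lemma fixed_cube_root_of_unity : gcdn 3 (q - 1) <> 1%N ->
  exists k : F, [/\ k != 0, s k = k, k ^+ 3 = 1 & k != 1].
Proof.
move=> hg; have d3 : (3 %| q - 1)%N.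
  have [_ hp] := primeP (isT : prime 3).
  have /orP[/eqP //|/eqP e] := hp _ (dvdn_gcdl 3 (q - 1)).
  by rewrite -e dvdn_gcdr.
have [k [k0 sk hk]] := fixed_generator sE q_gt1 hF hgamma.
have [n en] := dvdnP d3.
exists (k ^+ n); split.
- by rewrite expf_neq0.
- by rewrite rmorphXn /= sk.
- by rewrite -exprM -en fixed_exp.
- by apply: hk; move: q_gt1; lia.
Qed.

Section Polynomial.
Variables a b c d : F.

Let h X := cform a b c d (s X) X.

Lemma horner_poly_h X : (poly_h q a b c d).[X] = h X.
Proof.
have e3 : X ^+ (3 * q) = s X ^+ 3 by rewrite sE -exprM mulnC.
have e2 : X ^+ (2 * q + 1) = s X ^+ 2 * X by rewrite exprD expr1 sE -exprM mulnC.
have e1 : X ^+ (q + 2) = s X * X ^+ 2 by rewrite exprD sE.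
by rewrite /poly_h /h /cform !hornerE /= e3 e2 e1; ring.
Qed.

Let h_scale k X : s k = k -> h (k * X) = k ^+ 3 * h X.
Proof. by move=> sk; rewrite /h rmorphM sk /cform; ring. Qed.

Let h_unit X : X != 0 -> h X = X ^+ 3 * cform a b c d (s X / X) 1.
Proof. by move=> X0; rewrite /h (cform_hom _ _ _ _ _ X0). Qed.

Let h0 : h 0 = 0.
Proof. by rewrite /h rmorph0 /cform; ring. Qed.

(** Lines X F_q correspond to points x = X ^ (q - 1) of mu.  On a line h is the cube
    map up to a factor, and on the set of lines it is g. *)
Lemma permutation_polyP : permutation_poly (poly_h q a b c d) <->
  [/\ gcdn 3 (q - 1) = 1%N, nonvanishing s a b c d & injective_on_unitary s a b c d].
Proof.
have -> : permutation_poly (poly_h q a b c d) <-> injective h.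
  split=> [hb x y e | hi]; last first.
    by apply: injF_bij => x y; rewrite !horner_poly_h; apply: hi.
  by apply: (bij_inj hb); rewrite !horner_poly_h.
split=> [hi|[hg nv inj]].
  have hg : gcdn 3 (q - 1) = 1%N.
    apply/eqP; apply: contraT => /eqP/fixed_cube_root_of_unity[k [k0 sk k3 k1]].
    by case/eqP: k1; rewrite -[k]mulr1; apply: hi; rewrite h_scale // k3 mul1r.
  have nv : nonvanishing s a b c d.
    move=> x ux; have [X X0 sX] := hilbert90 sK sE q_gt1 hgamma ux.
    apply: contraNneq (X0) => e; have X0' := X0; apply/eqP; apply: hi.
    by rewrite h0 (h_unit X0') sX mulfK // e mulr0.
  split=> // x y ux uy e.
  have [X X0 sX] := hilbert90 sK sE q_gt1 hgamma ux.
  have [Y Y0 sY] := hilbert90 sK sE q_gt1 hgamma uy.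
  have Dx := nv _ ux; have Dy := nv _ uy.
  have hX : h X = X ^+ 3 * cform a b c d x 1 by rewrite h_unit // sX mulfK.
  have hY : h Y = Y ^+ 3 * cform a b c d y 1 by rewrite h_unit // sY mulfK.
  have hX0 : h X != 0 by rewrite hX mulf_neq0 ?expf_neq0.
  have hY0 : h Y != 0 by rewrite hY mulf_neq0 ?expf_neq0.
  have sh Z : s (h Z) = cform (s d) (s c) (s b) (s a) (s Z) Z.
    by rewrite (cform_swap sK) sK.
  have shX : s (h X) = X ^+ 3 * cform (s d) (s c) (s b) (s a) x 1.
    by rewrite sh (cform_hom _ _ _ _ _ X0) sX mulfK.
  have shY : s (h Y) = Y ^+ 3 * cform (s d) (s c) (s b) (s a) y 1.
    by rewrite sh (cform_hom _ _ _ _ _ Y0) sY mulfK.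
  (* the two values differ by an element of the fixed field, which is a cube there *)
  have sk : s (h X / h Y) = h X / h Y.
    have shY0 : s (h Y) != 0 by rewrite fmorph_eq0.
    rewrite fmorph_div; apply: (mulIf shY0); apply: (mulIf hY0); rewrite divfK //.
    rewrite mulrAC divfK // shX shY hX hY; apply: (lin_eq (eqM (X ^+ 3 * Y ^+ 3) e)); ring.
  have k0 : h X / h Y != 0 by rewrite mulf_neq0 ?invr_eq0.
  have [[k sk' k3] _] := fixed_cube hg k0 sk.
  have eX : X = k * Y by apply: hi; rewrite h_scale // k3 divfK.
  have sX0 : s X = x * (k * Y) by rewrite sX eX.
  have kY0 : k * Y != 0 by rewrite -eX.
  by apply: (mulIf kY0); rewrite -sX0 eX rmorphM sk' sY; ring.
have key Z : h Z = 0 -> Z = 0.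
  move=> e; apply/eqP; apply: contraT => Z0; move/eqP: e; rewrite h_unit //.
  by rewrite mulf_eq0 expf_eq0 /= (negPf Z0) (negPf (nv _ (conj_unit_power sK Z0))).
move=> X Y e; have [X0|X0] := eqVneq X 0.
  by rewrite X0; apply/esym/key; rewrite -e X0 h0.
have [Y0|Y0] := eqVneq Y 0; first by rewrite Y0; apply: key; rewrite e Y0 h0.
have uX := conj_unit_power sK X0; have uY := conj_unit_power sK Y0.
have exy : s X / X = s Y / Y.
  apply: inj => //.
  have k0 : X ^+ 3 * Y ^+ 3 != 0 by rewrite mulf_neq0 ?expf_neq0.
  apply: (mulfI k0).
  have sh Z : s (h Z) = cform (s d) (s c) (s b) (s a) (s Z) Z.
    by rewrite (cform_swap sK) sK.
  have eX : X ^+ 3 * cform a b c d (s X / X) 1 = h X by rewrite h_unit.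
  have eY : Y ^+ 3 * cform a b c d (s Y / Y) 1 = h Y by rewrite h_unit.
  have eX' : X ^+ 3 * cform (s d) (s c) (s b) (s a) (s X / X) 1 = s (h X).
    by rewrite sh [RHS](cform_hom _ _ _ _ _ X0).
  have eY' : Y ^+ 3 * cform (s d) (s c) (s b) (s a) (s Y / Y) 1 = s (h Y).
    by rewrite sh [RHS](cform_hom _ _ _ _ _ Y0).
  by rewrite mulrACA eX' eY e [X ^+ 3 * _]mulrC mulrACA eX eY' e mulrC.
have sk : s (X / Y) = X / Y.
  rewrite fmorph_div; have sY0 : s Y != 0 by rewrite fmorph_eq0.
  apply: (mulIf sY0); rewrite divfK // -[s Y](divfK Y0) -exy.
  by fld.
have k0 : X / Y != 0 by rewrite mulf_neq0 ?invr_eq0.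
have [_ k1] := fixed_cube hg k0 sk.
have eX : X = X / Y * Y by rewrite divfK.
have hX : h X = (X / Y) ^+ 3 * h Y by rewrite -h_scale // divfK.
rewrite eX k1 ?mul1r //; have hY0 : h Y != 0.
  by apply: contraNneq Y0 => /key ->.
by apply: (mulIf hY0); rewrite -hX mul1r.
Qed.
End Polynomial.

(** If 3 is invertible then it divides neither q nor q - 1, hence it divides q + 1 and
    a power of gamma has order three. *)
Lemma cube_root_exists (p m : nat) : prime p -> p \in [pchar F] -> q = (p ^ m)%N ->
  gcdn 3 (q - 1) = 1%N -> exists2 om : F, unitary s om & om ^+ 2 + om + 1 = 0.
Proof.
move=> pp pF qE hg; have [c3|c3] := eqVneq (3 : F) 0.
  exists 1; first by rewrite /unitary rmorph1 mulr1.
  by rewrite -c3; ring.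
have n3q : ~~ (3 %| q)%N.
  rewrite qE Euclid_dvdX // dvdn_prime2 //; apply/negP => /andP[/eqP e _]; case/eqP: c3.
  by rewrite e; apply: pcharf0.
have n3q1 : ~~ (3 %| q - 1)%N.
  by apply/negP => /gcdn_idPl; rewrite hg.
have /dvdnP[n en] : (3 %| q.+1)%N by move: n3q n3q1 q_gt1; lia.
exists (gamma ^+ n).
  apply/(unitaryE sE); rewrite -exprM mulnC exprM (prim_expr_order hgamma) expr1n //.
have g3 : (gamma ^+ n) ^+ 3 = 1 by rewrite -exprM -en (prim_expr_order hgamma).
have g1 : gamma ^+ n - 1 != 0.
  by rewrite subr_eq0 -(prim_order_dvd hgamma) gtnNdvd //; move: q_gt1; lia.
apply: (mulfI g1); apply: (lin_eq g3); ring.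
Qed.

End Permutation.

(** * The degree of a quotient of polynomials *)

Lemma repr_fraction (R : idomainType) (x : {fraction R}) :
  tofrac (\n_(repr x)) = x * tofrac (\d_(repr x)).
Proof.
rewrite -{2}[x]reprK; set r := repr x; unlock tofrac.
rewrite -[RHS]FracField.pi_mul; apply/eqmodP.
rewrite /= FracField.equivfE /FracField.mulf !numden_Ratio ?mulf_neq0 ?denom_ratioP ?oner_eq0 //.
by rewrite !mulr1 mul1r mulrC.
Qed.

Section Degree.
Variable K : fieldType.
Implicit Types n d r : {poly K}.

(** Two fractions with the same value have associate reduced forms; this is one half. *)
Lemma coprime_fraction_dvdp n d n' d' : coprimep n d -> n * d' = n' * d ->
  (n %| n') && (d %| d').
Proof.
move=> cop e; rewrite -(Gauss_dvdpl _ cop) -e dvdp_mulr //=.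
rewrite -(@Gauss_dvdpr _ _ n) 1?coprimep_sym // e.
exact: dvdp_mull.
Qed.

Lemma reduced_fraction_dvdp n d n' d' : d != 0 -> d' != 0 -> n * d' = n' * d ->
  (n %/ gcdp n d %| n' %/ gcdp n' d') && (d %/ gcdp n d %| d' %/ gcdp n' d').
Proof.
move=> d0 d'0 e.
have g0 : gcdp n d != 0 by rewrite gcdp_eq0 (negPf d0) andbF.
have g'0 : gcdp n' d' != 0 by rewrite gcdp_eq0 (negPf d'0) andbF.
apply: coprime_fraction_dvdp; first by apply: coprimep_div_gcd; rewrite d0 orbT.
apply: (mulIf (mulf_neq0 g0 g'0)).
transitivity ((n %/ gcdp n d * gcdp n d) * (d' %/ gcdp n' d' * gcdp n' d')).
  by rewrite mulrACA.
rewrite !divpK ?dvdp_gcdl ?dvdp_gcdr // e.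
transitivity ((n' %/ gcdp n' d' * gcdp n' d') * (d %/ gcdp n d * gcdp n d)); last first.
  by rewrite mulrACA [gcdp n d * _]mulrC.
by rewrite !divpK ?dvdp_gcdl ?dvdp_gcdr.
Qed.

Lemma rat_degree_quotient n d : d != 0 ->
  rat_degree (tofrac n / tofrac d) =
  maxn (size (n %/ gcdp n d)).-1 (size (d %/ gcdp n d)).-1.
Proof.
move=> d0; rewrite /rat_degree /reduced_num /reduced_den.
set g := _ / _; set n1 := \n_ _; set d1 := \d_ _.
have d10 : d1 != 0 := denom_ratioP _.
have e : n1 * d = n * d1.
  apply/eqP; rewrite -tofrac_eq !rmorphM /= repr_fraction -/d1 /g.
  have d0' : tofrac d != 0 by rewrite tofrac_eq0.
  by rewrite mulrAC divfK.
have /andP[h1 h2] := reduced_fraction_dvdp d10 d0 e.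
have /andP[h3 h4] := reduced_fraction_dvdp d0 d10 (esym e).
by congr (maxn _.-1 _.-1); apply: eqp_size; rewrite /eqp ?h1 ?h2 ?h3 ?h4.
Qed.

Lemma rat_degree_common_factor n d r : d != 0 -> r %| n -> r %| d ->
  (size n <= 4)%N -> (size d <= 4)%N -> (rat_degree (tofrac n / tofrac d) <= 4 - size r)%N.
Proof.
move=> d0 rn rd sn sd; rewrite rat_degree_quotient //.
have g0 : gcdp n d != 0 by rewrite gcdp_eq0 (negPf d0) andbF.
have : (size r <= size (gcdp n d))%N by apply: dvdp_leq; rewrite // dvdp_gcd rn.
rewrite !size_divp // geq_max; move: (size n) (size d) (size r) (size (gcdp _ _)) sn sd => *.
by apply/andP; split; lia.
Qed.

End Degree.

Section Cubics.
Variables (F : finFieldType) (s : {rmorphism F -> F}) (q : nat).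
Hypothesis sK : involutive s.
Hypothesis sE : forall x, s x = x ^+ q.

Lemma horner_polyD (a b c d x : F) : (polyD a b c d).[x] = cform a b c d x 1.
Proof. by rewrite /polyD /cform !hornerE /=; ring. Qed.

Lemma polyN_polyD a b c d : polyN q a b c d = polyD (s d) (s c) (s b) (s a).
Proof. by rewrite /polyN !sE. Qed.

Lemma coef_polyD (a b c d : F) i : (polyD a b c d)`_i = nth 0 [:: d; c; b; a] i.
Proof.
rewrite /polyD !coefE; case: i => [|[|[|[|i]]]] /=;
  by rewrite ?mulr0 ?mulr1 ?addr0 ?add0r // nth_nil.
Qed.

Lemma size_polyD_leq (a b c d : F) : (size (polyD a b c d) <= 4)%N.
Proof. by apply/leq_sizeP => j hj; rewrite coef_polyD nth_default. Qed.

Lemma size_polyD0 (b c d : F) : (size (polyD 0 b c d) <= 3)%N.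
Proof.
by apply/leq_sizeP => [[|[|[|[|j]]]]] // _; rewrite coef_polyD //= nth_nil.
Qed.

Lemma size_polyD_eq4 (a b c d : F) : (size (polyD a b c d) <= 3)%N -> a = 0.
Proof. by move/leq_sizeP/(_ 3%N (leqnn _)); rewrite coef_polyD. Qed.

Lemma polyD_eq0 (a b c d : F) : polyD a b c d = 0 -> [/\ a = 0, b = 0, c = 0 & d = 0].
Proof.
move=> e; have h i : nth 0 [:: d; c; b; a] i = 0 by rewrite -coef_polyD e coef0.
by split; [exact: (h 3%N) | exact: (h 2%N) | exact: (h 1%N) | exact: (h 0%N)].
Qed.

Variables a b c d : F.
Hypothesis nz : ~ [/\ a = 0, b = 0, c = 0 & d = 0].

Let D := polyD a b c d.
Let N := polyN q a b c d.
Let H := gcdp N D.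

Let D0 : D != 0.
Proof. by apply/eqP => /polyD_eq0. Qed.

Let H0 : H != 0.
Proof. by rewrite gcdp_eq0 (negPf D0) andbF. Qed.

Let hD x : D.[x] = cform a b c d x 1.
Proof. exact: horner_polyD. Qed.

Let hN x : N.[x] = cform (s d) (s c) (s b) (s a) x 1.
Proof. by rewrite /N polyN_polyD horner_polyD. Qed.

Let sD : (size D <= 4)%N.
Proof. exact: size_polyD_leq. Qed.

Let sN : (size N <= 4)%N.
Proof. by rewrite /N polyN_polyD size_polyD_leq. Qed.

Let degE : rat_degree (rat_g q a b c d) = maxn (size (N %/ H)).-1 (size (D %/ H)).-1.
Proof. exact: rat_degree_quotient. Qed.

Let NH : N = N %/ H * H.
Proof. by rewrite divpK ?dvdp_gcdl. Qed.

Let DH : D = D %/ H * H.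
Proof. by rewrite divpK ?dvdp_gcdr. Qed.

Let cop : coprimep (N %/ H) (D %/ H).
Proof. by apply: coprimep_div_gcd; rewrite D0 orbT. Qed.

Lemma degree3_no_common_root z : rat_degree (rat_g q a b c d) = 3%N ->
  cform a b c d z 1 = 0 -> cform (s d) (s c) (s b) (s a) z 1 <> 0.
Proof.
move=> deg; rewrite -hD -hN => /rootP; rewrite -dvdp_XsubCl => rD /rootP.
rewrite -dvdp_XsubCl => rN.
have := rat_degree_common_factor D0 rN rD sN sD.
by rewrite -[rat_degree _]/(rat_degree (rat_g q a b c d)) deg size_XsubC.
Qed.

Lemma degree3_no_quadratic_factor A B : rat_degree (rat_g q a b c d) = 3%N ->
  'X^2 + A *: 'X + B%:P %| D -> 'X^2 + A *: 'X + B%:P %| N -> False.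
Proof.
move=> deg rD rN.
have := rat_degree_common_factor D0 rN rD sN sD.
rewrite -[rat_degree _]/(rat_degree (rat_g q a b c d)) deg.
rewrite -addrA size_polyDl size_polyXn //.
rewrite (leq_ltn_trans (size_polyD _ _)) // gtn_max.
rewrite (leq_ltn_trans (size_scale_leq _ _)) ?size_polyX //.
by rewrite (leq_ltn_trans (size_polyC_leq1 _)).
Qed.

Lemma degree3_nonvanishing : rat_degree (rat_g q a b c d) = 3%N -> nonvanishing s a b c d.
Proof.
move=> deg x ux; apply/eqP => e; apply: (degree3_no_common_root deg e).
by rewrite cform_conj // e rmorph0 mulr0.
Qed.

(** The reflection x |-> 1 / s(x) exchanges N and D up to a factor, so it preserves
    their common zeros. *)
Lemma conj_root r : r != 0 -> cform a b c d r 1 = 0 ->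
   cform (s d) (s c) (s b) (s a) r 1 = 0 ->
   cform a b c d (s r)^-1 1 = 0 /\ cform (s d) (s c) (s b) (s a) (s r)^-1 1 = 0.
Proof.
move=> r0 hr hr'; have sr0 : s r != 0 by rewrite fmorph_eq0.
split.
  move/eqP: hr'; rewrite cform_swap // fmorph_eq0 rmorph1 => /eqP hr'.
  apply: (mulfI (expf_neq0 3 sr0)); rewrite mulr0; apply: (lin_eq hr').
  by rewrite /cform; fld.
rewrite cform_swap // rmorph1 fmorphV sK.
apply/eqP; rewrite fmorph_eq0; apply/eqP; apply: (mulfI (expf_neq0 3 r0)).
by rewrite mulr0; apply: (lin_eq hr); rewrite /cform; fld.
Qed.

(** If the degree were 2, the common factor of N and D as binary forms would be linear
    and stable under x |-> 1 / s(x).  Its root would be a zero of D on mu; the pair 0,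
    infinity cannot occur because it would contribute two factors. *)
Lemma permuting_degree x0 : unitary s x0 -> x0 != 1 ->
  nonvanishing s a b c d -> injective_on_unitary s a b c d ->
  rat_degree (rat_g q a b c d) = 3%N \/ rat_degree (rat_g q a b c d) = 1%N.
Proof.
move=> ux0 x01 nv inj; have u1 : unitary s 1 by rewrite /unitary rmorph1 mulr1.
have rootH x : root H x = (D.[x] == 0) && (N.[x] == 0).
  by rewrite root_gcd andbC.
have le3 : (rat_degree (rat_g q a b c d) <= 3)%N.
  have := rat_degree_common_factor D0 (dvd1p N) (dvd1p D) sN sD.
  by rewrite size_poly1.
have szN : N != 0 -> size N = (size (N %/ H) + size H).-1.
  move=> N0; rewrite {1}NH size_mul //.
  by apply: contraNneq N0 => e; rewrite NH e mul0r.
have szD : size D = (size (D %/ H) + size H).-1.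
  by rewrite {1}DH size_mul //; apply: contraNneq D0 => e; rewrite DH e mul0r.
have H1 : (0 < size H)%N by rewrite size_poly_gt0.
have n0 : rat_degree (rat_g q a b c d) <> 0%N.
  rewrite degE => /eqP; rewrite -leqn0 geq_max => /andP[hn hd].
  have cN : (size (N %/ H)%R <= 1)%N by lia.
  have cD : (size (D %/ H)%R <= 1)%N by lia.
  case/eqP: x01; apply: (inj _ _ ux0 u1).
  rewrite -!hN -!hD NH DH (size1_polyC cN) (size1_polyC cD) !hornerM !hornerC.
  by rewrite mulrACA [H.[x0] * _]mulrC -mulrACA.
have n2 : rat_degree (rat_g q a b c d) <> 2%N.
  move=> deg2; have := degE; rewrite deg2 !size_divp // => e2.
  have [/andP[/eqP a0 /eqP d0]|ad] := boolP ((a == 0) && (d == 0)).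
    have sD3 : (size D <= 3)%N by rewrite /D a0; apply: size_polyD0.
    have sN3 : (size N <= 3)%N by rewrite /N polyN_polyD d0 rmorph0; apply: size_polyD0.
    have rH : root H 0.
      by rewrite rootH hD hN /cform a0 d0 !rmorph0 !(expr0n, mulr0, mul0r, addr0) eqxx.
    have h2 := root_size_gt1 H0 rH; move: e2 sD3 sN3 h2.
    by move: (size N) (size D) (size H) => *; lia.
  have h4 : size D = 4%N \/ size N = 4%N.
    have [a0|a0] := eqVneq a 0.
      right; apply/eqP; rewrite eqn_leq sN ltnNge; apply: contra ad.
      rewrite /N polyN_polyD => /size_polyD_eq4/eqP; rewrite fmorph_eq0 => ->.
      by rewrite a0 eqxx.
    left; apply/eqP; rewrite eqn_leq sD ltnNge; apply: contra a0.
    by move/size_polyD_eq4->.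
  have sH : size H = 2%N.
    move: e2 sD sN H1 h4; move: (size N) (size D) (size H) => *; lia.
  have [r /eqP rr] := poly2_root sH; have rHr : root H r by apply/eqP.
  have : root H r by []; rewrite rootH hD hN => /andP[/eqP Dr /eqP Nr].
  have r0 : r != 0.
    apply: contra ad => /eqP r0; move: Dr Nr; rewrite r0 /cform => Dr Nr.
    have -> : d = 0 by apply: (lin_eq Dr); ring.
    have /eqP : s a = 0 by apply: (lin_eq Nr); ring.
    by rewrite fmorph_eq0 => ->; rewrite eqxx.
  have [Dr' Nr'] := conj_root r0 Dr Nr.
  have rHr' : root H (s r)^-1 by rewrite rootH hD hN Dr' Nr' eqxx.
  have rr' : r = (s r)^-1.
    apply/eqP; apply: contraT => neq.
    have := @max_poly_roots _ H [:: r; (s r)^-1] H0.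
    by rewrite /= rHr rHr' inE neq sH; move=> /(_ isT isT).
  have ur : unitary s r.
    by rewrite /unitary {1}rr' mulVf // fmorph_eq0.
  by case/eqP: (nv _ ur).
by move: le3 n0 n2; case: (rat_degree _) => [|[|[|[|k]]]] //; [right | left].
Qed.

Lemma degree1_permuting : rat_degree (rat_g q a b c d) = 1%N ->
  (nonvanishing s a b c d /\ injective_on_unitary s a b c d <->
   forall x, unitary s x -> ~~ root H x).
Proof.
move=> deg; split=> [[nv _] x ux | nr].
  by rewrite root_gcd negb_and orbC rootE hD nv.
split=> [x ux|].
  apply: contra (nr x ux) => /eqP Dx; rewrite root_gcd !rootE hD hN cform_conj // Dx.
  by rewrite rmorph0 mulr0 eqxx.
have := degE; rewrite deg => e1.
have sN1 : (size (N %/ H)%R <= 2)%N by move: e1; lia.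
have sD1 : (size (D %/ H)%R <= 2)%N by move: e1; lia.
move=> x y ux uy; rewrite -!hN -!hD NH DH !hornerM => e.
have Hx : H.[x] != 0 := nr x ux; have Hy : H.[y] != 0 := nr y uy.
have {}e : (N %/ H).[x] * (D %/ H).[y] = (N %/ H).[y] * (D %/ H).[x].
  apply: (mulIf (mulf_neq0 Hx Hy)); rewrite mulrACA e mulrACA [H.[x] * _]mulrC //.
have lin (P : {poly F}) : (size P <= 2)%N -> P = P`_1 *: 'X + (P`_0)%:P.
  move=> sP; apply/polyP => i; rewrite !coefE; case: i => [|[|i]] /=;
    rewrite ?mulr0 ?mulr1 ?addr0 ?add0r //; apply: nth_default; apply: leq_trans sP _ => //.
move: e1 cop e sN1 sD1; move: (N %/ H) (D %/ H) => n1 d1 e1 cp e sn sd.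
have ln z : n1.[z] = n1`_1 * z + n1`_0 by rewrite {1}(lin _ sn) !hornerE.
have ld z : d1.[z] = d1`_1 * z + d1`_0 by rewrite {1}(lin _ sd) !hornerE.
have : (n1`_1 * d1`_0 - n1`_0 * d1`_1) * (x - y) = 0.
  by move: e; rewrite !ln !ld => e; apply: (lin_eq e); ring.
move/eqP; rewrite mulf_eq0 => /orP[/eqP det | ]; last by rewrite subr_eq0 => /eqP.
have prop : n1`_1 *: d1 = d1`_1 *: n1.
  apply/polyP => [[|[|k]]]; rewrite !coefZ.
  - by apply: (lin_eq det); ring.
  - by rewrite mulrC.
  - have -> : n1`_k.+2 = 0 by apply: nth_default; apply: leq_trans sn _.
    have -> : d1`_k.+2 = 0 by apply: nth_default; apply: leq_trans sd _.
    by rewrite !mulr0.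
exfalso; have [dd|dd] := eqVneq (d1`_1) 0.
  have [nn|nn] := eqVneq (n1`_1) 0.
    have sn1 : (size n1 <= 1)%N by rewrite (lin _ sn) nn scale0r add0r size_polyC_leq1.
    have sd1 : (size d1 <= 1)%N by rewrite (lin _ sd) dd scale0r add0r size_polyC_leq1.
    by move: e1 sn1 sd1; clear; lia.
  have d10 : d1 = 0.
    apply/eqP; have := congr1 (fun P => P == 0) prop.
    by rewrite /= dd scale0r eqxx scaler_eq0 (negPf nn).
  move: cp; rewrite d10 coprimep0 => /eqp_size; rewrite size_poly1 => sz.
  by move: nn; rewrite nth_default ?eqxx // sz.
have en : n1 = (n1`_1 / d1`_1) *: d1.
  by rewrite mulrC -scalerA prop scalerA mulVf // scale1r.
have sd2 : size d1 = 2%N.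
  by apply/eqP; rewrite eqn_leq sd ltnNge; apply: contra dd => h; rewrite nth_default.
have [nn|nn] := eqVneq (n1`_1) 0.
  move: cp; rewrite en nn mul0r scale0r coprime0p => /eqp_size.
  by rewrite size_poly1 sd2.
by move: cp; rewrite en coprimepZl ?mulf_neq0 ?invr_eq0 // coprimepp sd2.
Qed.
End Cubics.

(** * Separability and the derivative *)

Section QuotientRule.
Variable K : fieldType.

(** The derivative of a fraction does not depend on the chosen numerator and
    denominator. *)
Lemma quotient_rule_wd (n d n1 d1 n' d' n1' d1' : K) : d != 0 -> d1 != 0 ->
  n1 * d = n * d1 -> n1' * d + n1 * d' = n' * d1 + n * d1' ->
  (n1' * d1 - n1 * d1') / d1 ^+ 2 = (n' * d - n * d') / d ^+ 2.
Proof.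
move=> d0 d10 e e'; have k0 : d ^+ 2 * d1 ^+ 2 != 0 by rewrite mulf_neq0 ?expf_neq0.
apply: (mulfI k0).
apply: (lin_eq (eqD (eqM (d1 * d) e') (eqM (- (d1' * d + d1 * d')) e))).
by fld.
Qed.

Lemma quotient_ruleD (n d e f n' d' e' f' : K) : d != 0 -> f != 0 ->
  ((n' * f + n * f' + (e' * d + e * d')) * (d * f) -
     (n * f + e * d) * (d' * f + d * f')) / (d * f) ^+ 2
  = (n' * d - n * d') / d ^+ 2 + (e' * f - e * f') / f ^+ 2.
Proof. by move=> d0 f0; fld. Qed.

Lemma quotient_ruleM (n d e f n' d' e' f' : K) : d != 0 -> f != 0 ->
  ((n' * e + n * e') * (d * f) - (n * e) * (d' * f + d * f')) / (d * f) ^+ 2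
  = (n' * d - n * d') / d ^+ 2 * (e / f) + n / d * ((e' * f - e * f') / f ^+ 2).
Proof. by move=> d0 f0; fld. Qed.

End QuotientRule.

(** Zero derivative leaves only the exponents divisible by p. *)
Lemma pth_power_poly (K : fieldType) (p : nat) (P : {poly K}) : p \in [pchar K] ->
  P^`() = 0 -> (forall i, exists r, r ^+ p = P`_i) -> exists R, P = R ^+ p.
Proof.
move=> pK dP hr; have p0 : (0 < p)%N by apply: prime_gt0; apply: pcharf_prime pK.
have hr' i : exists r, r ^+ p == P`_i by have [r <-] := hr i; exists r.
pose h i := xchoose (hr' i); have hh i : h i ^+ p = P`_i := eqP (xchooseP (hr' i)).
have pP : p \in [pchar {poly K}] by rewrite pchar_poly.
exists (\poly_(j < size P) h (j * p)%N).
rewrite poly_def -(pFrobenius_autE pP) rmorph_sum /=.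
under eq_bigr do rewrite pFrobenius_autE exprZn hh -exprM.
apply/polyP => i; rewrite coef_sum.
have [/dvdnP[j ->]|ndiv] := boolP (p %| i)%N.
  have p_inj (k : nat) : (j * p == k * p)%N = (j == k) by rewrite eqn_pmul2r.
  have [hj|hj] := ltnP j (size P).
    rewrite (bigD1 (Ordinal hj)) //= coefZ coefXn eqxx mulr1 big1 ?addr0 // => k nk.
    rewrite coefZ coefXn p_inj (_ : (j == k :> nat) = false) ?mulr0 //.
    by apply: contraNF nk => /eqP e; apply/eqP/val_inj.
  rewrite nth_default; last by apply: leq_trans hj _; rewrite leq_pmulr.
  rewrite big1 // => k _; rewrite coefZ coefXn p_inj.
  by rewrite gtn_eqF ?mulr0 // (leq_trans (ltn_ord k)).
have -> : P`_i = 0.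
  case: i ndiv => [|i ndiv]; first by rewrite dvdn0.
  have /eqP := congr1 (fun Q : {poly K} => Q`_i) dP.
  rewrite coef_deriv coef0 -mulr_natr mulf_eq0 => /orP[/eqP //|].
  by rewrite -(dvdn_pcharf pK) (negPf ndiv).
rewrite big1 // => k _; rewrite coefZ coefXn (_ : (i == k * p)%N = false) ?mulr0 //.
by apply: contraNF ndiv => /eqP ->; rewrite dvdn_mull.
Qed.

(** The field of rational functions enters only through an embedding of the
    polynomial ring and a choice of numerators and denominators, so that computations
    take place in an abstract field. *)
Section Separability.
Variables (K : finFieldType) (T : fieldType) (frac : {rmorphism {poly K} -> T}).
Variables num den : T -> {poly K}.
Hypothesis frac_inj : injective frac.
Hypothesis den_neq0 : forall f, den f != 0.
Hypothesis num_den : forall f, f = frac (num f) / frac (den f).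
Implicit Types f z : T.

Let frac_eq0 (P : {poly K}) : (frac P == 0) = (P == 0).
Proof. by rewrite -(inj_eq frac_inj) rmorph0. Qed.

Definition deriv_frac f : T :=
  (frac (num f)^`() * frac (den f) - frac (num f) * frac (den f)^`()) / frac (den f) ^+ 2.

Lemma deriv_fracE (n d : {poly K}) : d != 0 -> deriv_frac (frac n / frac d) =
  (frac n^`() * frac d - frac n * frac d^`()) / frac d ^+ 2.
Proof.
move=> d0; rewrite /deriv_frac; set f := frac n / frac d.
have := num_den f; have d10 := den_neq0 f.
move: (num f) (den f) d10 => n1 d1 d10 e1.
have d0' : frac d != 0 by rewrite frac_eq0.
have d10' : frac d1 != 0 by rewrite frac_eq0.
have e : n1 * d = n * d1.
  apply: frac_inj; rewrite !rmorphM.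
  by rewrite -[frac n1](divfK d10') -e1 mulrAC /f divfK.
apply: quotient_rule_wd; rewrite // -!rmorphM ?e // -!rmorphD.
by rewrite -!derivM e.
Qed.

Lemma deriv_fracD : {morph deriv_frac : f z / f + z}.
Proof.
move=> f z; rewrite (num_den f) (num_den z); have d0 := den_neq0 f; have d0' := den_neq0 z.
move: (num f) (den f) (num z) (den z) d0 d0' => n d n' d' d0 d'0.
have t0 : frac d != 0 by rewrite frac_eq0.
have t'0 : frac d' != 0 by rewrite frac_eq0.
rewrite addf_div // -!rmorphM -rmorphD !deriv_fracE ?mulf_neq0 //.
by rewrite derivD !derivM !(rmorphD, rmorphM) /= quotient_ruleD.
Qed.

Lemma deriv_fracM f z : deriv_frac (f * z) = deriv_frac f * z + f * deriv_frac z.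
Proof.
rewrite (num_den f) (num_den z); have d0 := den_neq0 f; have d0' := den_neq0 z.
move: (num f) (den f) (num z) (den z) d0 d0' => n d n' d' d0 d'0.
have t0 : frac d != 0 by rewrite frac_eq0.
have t'0 : frac d' != 0 by rewrite frac_eq0.
rewrite mulf_div -!rmorphM !deriv_fracE ?mulf_neq0 //.
by rewrite !derivM !(rmorphD, rmorphM) /= quotient_ruleM.
Qed.

Lemma deriv_frac_poly (P : {poly K}) : deriv_frac (frac P) = frac P^`().
Proof.
rewrite -[frac P]divr1 -(rmorph1 frac) deriv_fracE ?oner_neq0 //.
by rewrite rmorph1 derivC rmorph0 mulr0 subr0 expr1n mulr1 divr1.
Qed.

Lemma deriv_frac0 : deriv_frac 0 = 0.
Proof. by rewrite -(rmorph0 frac) deriv_frac_poly deriv0. Qed.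

Lemma deriv_frac1 : deriv_frac 1 = 0.
Proof. by rewrite -(rmorph1 frac) deriv_frac_poly derivC rmorph0. Qed.

Definition const (k : K) : T := frac k%:P.

Lemma deriv_frac_const k : deriv_frac (const k) = 0.
Proof. by rewrite deriv_frac_poly derivC rmorph0. Qed.

Lemma deriv_frac_div f z : deriv_frac f = 0 -> deriv_frac z = 0 -> z != 0 -> deriv_frac (f / z) = 0.
Proof.
move=> hf hz z0; apply: (mulIf z0); rewrite mul0r.
by have := deriv_fracM (f / z) z; rewrite divfK // hf hz mulr0 addr0.
Qed.

Definition deriv_coefs (P : {poly T}) := map_poly deriv_frac P.

Lemma coef_deriv_coefs P i : (deriv_coefs P)`_i = deriv_frac P`_i.
Proof. by rewrite coef_map_id0 ?deriv_frac0. Qed.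

Lemma deriv_frac_horner (P : {poly T}) z :
  deriv_frac P.[z] = (deriv_coefs P).[z] + P^`().[z] * deriv_frac z.
Proof.
elim/poly_ind: P => [|P c IH].
  have -> : deriv_coefs 0 = 0 by apply/polyP => i; rewrite coef_deriv_coefs !coef0 deriv_frac0.
  by rewrite deriv0 !horner0 deriv_frac0 mul0r addr0.
have -> : deriv_coefs (P * 'X + c%:P) = deriv_coefs P * 'X + (deriv_frac c)%:P.
  apply/polyP => i; rewrite coef_deriv_coefs !coefD !coefMX !coefC deriv_fracD.
  by case: i => [|i] /=; rewrite ?coef_deriv_coefs deriv_frac0.
rewrite derivD derivM derivX derivC addr0 mulr1 !hornerD !hornerMX !hornerC.
by rewrite deriv_fracD deriv_fracM IH; ring.
Qed.

Definition evalf (u : {poly K}) z : T := (map_poly (frac \o polyC) u).[z].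

Lemma evalfD (u v : {poly K}) z : evalf (u + v) z = evalf u z + evalf v z.
Proof. by rewrite /evalf rmorphD hornerD. Qed.
Lemma evalfM (u v : {poly K}) z : evalf (u * v) z = evalf u z * evalf v z.
Proof. by rewrite /evalf rmorphM hornerM. Qed.
Lemma evalfX (u : {poly K}) n z : evalf (u ^+ n) z = evalf u z ^+ n.
Proof. by rewrite /evalf rmorphXn horner_exp. Qed.
Lemma evalfC k z : evalf k%:P z = const k.
Proof. by rewrite /evalf map_polyC hornerC. Qed.
Lemma evalf_id z : evalf 'X z = z.
Proof. by rewrite /evalf map_polyX hornerX. Qed.

Lemma deriv_frac_eval u z : deriv_frac (evalf u z) = evalf u^`() z * deriv_frac z.
Proof.
rewrite /evalf deriv_frac_horner.
have -> : deriv_coefs (map_poly (frac \o polyC) u) = 0.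
  apply/polyP => i; rewrite coef_deriv_coefs coef_map_id0 ?rmorph0 ?coef0 //.
  exact: deriv_frac_const.
by rewrite horner0 add0r deriv_map.
Qed.


(** When g has derivative zero, so has every element of K(g).  Differentiating
    P(x) = 0 then gives P'(x) = 0 for every P over K(g). *)
Lemma inseparable_root g (P : {poly T}) x : deriv_frac g = 0 -> deriv_frac x != 0 ->
  (forall i, exists u v : {poly K}, evalf v g != 0 /\ P`_i = evalf u g / evalf v g) ->
  root P x -> ~ separable_poly P.
Proof.
move=> dg dx hP rP sP.
have P0 : deriv_coefs P = 0.
  apply/polyP => i; rewrite coef_deriv_coefs coef0; have [u [v [v0 ->]]] := hP i.
  by apply: deriv_frac_div => //; rewrite deriv_frac_eval dg mulr0.
have : root P^`() x.
  have := deriv_frac_horner P x; rewrite P0 (rootP rP) horner0 deriv_frac0 add0r.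
  by move/esym/eqP; rewrite mulf_eq0 (negPf dx) orbF.
by apply/negP; apply: coprimep_root rP; move: sP; rewrite unlock.
Qed.


Section SubstitutionMorphism.
Variables (p : nat) (g : T).
Hypothesis pcharKp : p \in [pchar K].
Hypothesis dg0 : deriv_frac g != 0.

Let p_gt1 : (1 < p)%N.
Proof. by apply: prime_gt1; apply: pcharf_prime pcharKp. Qed.

Let pcharTp : p \in [pchar T].
Proof. by rewrite (fmorph_pchar (frac \o polyC)). Qed.

Let pth_root k : exists r : K, r ^+ p = k.
Proof.
have inj : injective (pFrobenius_aut pcharKp) by apply: fmorph_inj.
by have [h _ hK] := injF_bij inj; exists (h k); rewrite -(pFrobenius_autE pcharKp) hK.
Qed.

Let poly_pth_root (u : {poly K}) : u^`() = 0 -> exists w, u = w ^+ p.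
Proof. by move=> du; apply: pth_power_poly pcharKp du _ => i; apply: pth_root. Qed.

Let size_pth_root (R : fieldType) (P Q : {poly R}) : P = Q ^+ p -> (1 < size P)%N ->
  (size Q < size P)%N.
Proof.
move=> -> h; have := h; have := size_exp Q p; move: h.
by move: (size Q) (size (Q ^+ p)) p_gt1 => [|a] [|b] //=; nia.
Qed.

(** An element with nonzero derivative is transcendental: differentiate an algebraic
    relation, or take its p-th root if the relation itself has derivative zero. *)
Lemma evalf_neq0 (v : {poly K}) : v != 0 -> evalf v g != 0.
Proof.
have [n] := ubnP (size v); elim: n v => // n IH v; rewrite ltnS => hv v0.
apply/eqP => e.
have [s1|s1] := leqP (size v) 1.
  move: e v0; rewrite (size1_polyC s1) evalfC polyC_eq0 => /eqP.
  by rewrite frac_eq0 polyC_eq0 => /eqP ->; rewrite eqxx.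
have [dv|dv] := eqVneq v^`() 0.
  have [w ew] := poly_pth_root dv.
  have sw := size_pth_root ew s1.
  have w0 : w != 0 by apply: contraNneq v0 => w0; rewrite ew w0 expr0n gtn_eqF // ltnW.
  have /eqP : evalf w g ^+ p = 0 by rewrite -evalfX -ew.
  rewrite expf_eq0 => /andP[_]; apply/negP; apply: IH => //.
  exact: leq_trans sw hv.
have := deriv_frac_eval v g; rewrite e deriv_frac0 => /esym/eqP.
rewrite mulf_eq0 (negPf dg0) orbF; apply/negP; apply: IH => //.
by apply: leq_trans (lt_size_deriv v0) hv.
Qed.

(**The field morphism from K(t) to K(x) that sends t to g; its image is K(g). *)
Definition subst_frac f := evalf (num f) g / evalf (den f) g.

Lemma subst_fracE (n d : {poly K}) : d != 0 -> subst_frac (frac n / frac d) = evalf n g / evalf d g.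
Proof.
move=> d0; rewrite /subst_frac; set f := frac n / frac d.
have := num_den f; have d10 := den_neq0 f.
move: (num f) (den f) d10 => n1 d1 d10 e1.
have d0' : frac d != 0 by rewrite frac_eq0.
have d10' : frac d1 != 0 by rewrite frac_eq0.
have e : n1 * d = n * d1.
  apply: frac_inj; rewrite !rmorphM.
  by rewrite -[frac n1](divfK d10') -e1 mulrAC /f divfK.
have := congr1 (evalf ^~ g) e; rewrite !evalfM => e'.
have k0 := evalf_neq0 d0; have k1 := evalf_neq0 d10.
apply: (mulIf k0); apply: (mulIf k1); rewrite divfK // -e' mulrAC divfK //.
Qed.

Lemma subst_fracD : {morph subst_frac : f z / f + z}.
Proof.
move=> f z; rewrite (num_den f) (num_den z); have d0 := den_neq0 f; have d0' := den_neq0 z.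
move: (num f) (den f) (num z) (den z) d0 d0' => n d n' d' d0 d'0.
have t0 : frac d != 0 by rewrite frac_eq0.
have t'0 : frac d' != 0 by rewrite frac_eq0.
rewrite addf_div // -!rmorphM -rmorphD !subst_fracE ?mulf_neq0 //.
by rewrite addf_div ?evalf_neq0 // evalfD !evalfM.
Qed.

Lemma subst_fracM : {morph subst_frac : f z / f * z}.
Proof.
move=> f z; rewrite (num_den f) (num_den z); have d0 := den_neq0 f; have d0' := den_neq0 z.
move: (num f) (den f) (num z) (den z) d0 d0' => n d n' d' d0 d'0.
rewrite mulf_div -!rmorphM !subst_fracE ?mulf_neq0 //.
by rewrite mulf_div !evalfM.
Qed.

Lemma subst_frac_poly (u : {poly K}) : subst_frac (frac u) = evalf u g.
Proof.
by rewrite -[frac u]divr1 -(rmorph1 frac) subst_fracE ?oner_neq0 // evalfC /const polyC1 rmorph1 divr1.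
Qed.

Lemma subst_frac1 : subst_frac 1 = 1.
Proof. by rewrite -(rmorph1 frac) subst_frac_poly evalfC /const polyC1 rmorph1. Qed.

Lemma subst_fracB : {morph subst_frac : f z / f - z}.
Proof. by move=> f z; apply: (addIr (subst_frac z)); rewrite -subst_fracD !subrK. Qed.

HB.instance Definition _ := GRing.isZmodMorphism.Build T T subst_frac subst_fracB.
HB.instance Definition _ := GRing.isMonoidMorphism.Build T T subst_frac
  (conj subst_frac1 subst_fracM).

Lemma deriv_subst_frac f : deriv_frac (subst_frac f) = subst_frac (deriv_frac f) * deriv_frac g.
Proof.
have d0 := den_neq0 f; have k0 := evalf_neq0 d0.
have t0 : frac (den f) != 0 by rewrite frac_eq0.
have e : subst_frac f * evalf (den f) g = evalf (num f) g by rewrite divfK.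
have e' : deriv_frac f * frac (den f) + f * frac (den f)^`() = frac (num f)^`().
  rewrite -!deriv_frac_poly -deriv_fracM; congr deriv_frac.
  by rewrite {1}(num_den f) divfK.
have := congr1 deriv_frac e; rewrite deriv_fracM !deriv_frac_eval -!subst_frac_poly -e'.
rewrite rmorphD !rmorphM /= => h; apply: (mulIf k0); rewrite -subst_frac_poly.
by apply: (lin_eq h); rewrite /=; ring.
Qed.

Lemma algebraic_over_subst z : algebraicOver subst_frac z.
Proof.
have calg k : algebraicOver subst_frac (frac k%:P).
  have -> : frac k%:P = subst_frac (frac k%:P) by rewrite subst_frac_poly evalfC.
  exact: algebraic_id.
have xalg : algebraicOver subst_frac (frac 'X).
  pose P := map_poly (frac \o polyC) (num g) - frac 'X *: map_poly (frac \o polyC) (den g) : {poly T}.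
  have mapc (u : {poly K}) :
      map_poly subst_frac (map_poly (frac \o polyC) u) = map_poly (frac \o polyC) u.
    apply/polyP => i; rewrite !coef_map /= subst_frac_poly evalfC //.
  have evx (u : {poly K}) : (map_poly (frac \o polyC) u).[frac 'X] = frac u.
    elim/poly_ind: u => [|u k IH]; first by rewrite !rmorph0 horner0.
    by rewrite !rmorphD !rmorphM /= map_polyX map_polyC !hornerE IH.
  exists P.
    apply/eqP => /polyP/(_ (size (den g)).-1); rewrite coefB coefZ !coef_map coef0 /= => h.
    have lc : (den g)`_(size (den g)).-1 != 0 by rewrite -lead_coefE lead_coef_eq0.
    have : frac (((num g)`_(size (den g)).-1)%:P - 'X * ((den g)`_(size (den g)).-1)%:P) = 0.
      by rewrite rmorphB rmorphM.
    move/eqP; rewrite frac_eq0 => /eqP/polyP/(_ 1%N).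
    rewrite coefB coefC coefXM coefC coef0 /= sub0r => /eqP.
    by rewrite oppr_eq0 (negPf lc).
  rewrite rootE rmorphB /= linearZ /= !mapc subst_frac_poly evalf_id hornerD hornerN hornerZ !evx.
  have -> : frac (num g) = g * frac (den g) by rewrite {2}(num_den g) divfK // frac_eq0.
  by rewrite subrr.
have palg (u : {poly K}) : algebraicOver subst_frac (frac u).
  elim/poly_ind: u => [|u k IH]; first by rewrite rmorph0; apply: algebraic0.
  by rewrite rmorphD rmorphM; apply: algebraic_add => //; apply: algebraic_mul.
by rewrite (num_den z); apply: algebraic_div.
Qed.

Let deriv0_pth_root f : deriv_frac f = 0 -> exists r, r ^+ p = f.
Proof.
move=> df; pose n := num f; pose d := den f.
have t0 : frac d != 0 by rewrite frac_eq0 den_neq0.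
have e : n^`() * d - n * d^`() = 0.
  apply/eqP; rewrite -frac_eq0 rmorphB !rmorphM /=.
  move/eqP: df; rewrite /deriv_frac mulf_eq0 invr_eq0 expf_eq0 /= (negPf t0) orbF //.
have p1 : (p.-2.+2 = p)%N by move: p_gt1; lia.
have : (n * d ^+ p.-1)^`() = 0.
  have -> : p.-1 = p.-2.+1 by move: p_gt1; lia.
  rewrite derivM deriv_exp -mulr_natl /=.
  have -> : (p.-2.+1%:R : {poly K}) = - 1.
    by apply/eqP; rewrite -addr_eq0 natr1 p1 -polyC_natr (pcharf0 pcharKp) polyC0.
  have rearr (R : comNzRingType) (x y z z' c : R) :
    x * (z * c) + y * (- 1 * (z' * c)) = (x * z - y * z') * c by ring.
  by rewrite exprS rearr e mul0r.
move/poly_pth_root => [w ew]; exists (frac w / frac d).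
rewrite expr_div_n -rmorphXn -ew rmorphM rmorphXn (num_den f) -/n -/d.
by rewrite -{2}(prednK (ltnW p_gt1)) exprS -mulf_div divff ?mulr1 // expf_neq0.
Qed.

(** A monic polynomial of least degree that vanishes at z is separable.  If not, its
    derivative is zero by irreducibility.  Applying the derivation of K(x) to the
    relation gives a relation of smaller degree with coefficients the derivatives of
    the old ones, so these vanish as well, the coefficients are p-th powers, and the
    polynomial is the p-th power of a smaller one that vanishes at z. *)
Lemma separable_over_subst z : exists P,
  separable_poly (map_poly subst_frac P) /\ root (map_poly subst_frac P) z.
Proof.
have [P0 P00 rP0] := algebraic_over_subst z.
have [n] := ubnP (size P0); elim: n P0 P00 rP0 => // n IH P P0 rP; rewrite ltnS => sP.
have [Q [Q0 rQ sQ mQ]] : exists Q,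
    [/\ Q != 0, root (map_poly subst_frac Q) z, size Q = size P & Q \is monic].
  have l0 : (lead_coef P)^-1 != 0 by rewrite invr_eq0 lead_coef_eq0.
  exists ((lead_coef P)^-1 *: P); split; rewrite ?scaler_eq0 ?negb_or ?l0 ?size_scale //.
    by rewrite linearZ /= rootZ // fmorph_eq0.
  by rewrite monicE lead_coefZ mulVf // lead_coef_eq0.
rewrite -sQ in sP; move: {P P0 rP sQ} Q Q0 rQ sP mQ => P P0 rP sP mP.
have s1 : (1 < size P)%N.
  have := root_size_gt1 _ rP; rewrite size_map_poly; apply.
  by rewrite map_poly_eq0.
have small Q : Q != 0 -> root (map_poly subst_frac Q) z -> (size Q < size P)%N ->
    exists P, separable_poly (map_poly subst_frac P) /\ root (map_poly subst_frac P) z.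
  by move=> Q0 rQ sQ; apply: (IH Q) => //; apply: leq_trans sQ sP.
have [dP|dP] := eqVneq P^`() 0.
  have [dc|dc] := eqVneq (deriv_coefs P) 0.
    have [R eR] : exists R, P = R ^+ p.
      apply: pth_power_poly pcharTp dP _ => i; apply: deriv0_pth_root.
      by rewrite -coef_deriv_coefs dc coef0.
    apply: (small R); last exact: size_pth_root eR s1.
      by apply: contraNneq P0 => R0; rewrite eR R0 expr0n gtn_eqF // ltnW.
    by move: rP; rewrite eR rmorphXn /= rootE horner_exp expf_eq0 => /andP[].
  apply: (small (deriv_coefs P)) => //.
    have := deriv_frac_horner (map_poly subst_frac P) z.
    rewrite (rootP rP) deriv_frac0 deriv_map dP rmorph0 horner0 mul0r addr0.
    have -> : deriv_coefs (map_poly subst_frac P) = deriv_frac g *: map_poly subst_frac (deriv_coefs P).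
      apply/polyP => i; rewrite coef_deriv_coefs coefZ !coef_map /= coef_deriv_coefs.
      by rewrite deriv_subst_frac mulrC.
    by rewrite hornerZ => /esym/eqP; rewrite mulf_eq0 (negPf dg0).
  have : (size (deriv_coefs P) <= (size P).-1)%N.
    apply/leq_sizeP => j hj; rewrite coef_deriv_coefs.
    have [ej|nj] := eqVneq j (size P).-1.
      by rewrite ej -lead_coefE (monicP mP) deriv_frac1.
    rewrite nth_default ?deriv_frac0 //.
    by rewrite -(ltn_predK s1) ltn_neqAle eq_sym nj.
  by move: s1; lia.
have [cop|ncop] := boolP (coprimep P P^`()).
  exists P; split=> //; rewrite unlock deriv_map coprimep_map //.
pose G := gcdp P P^`().
have G0 : G != 0 by rewrite gcdp_eq0 (negPf P0).
have sG : (size G < size P)%N.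
  apply: leq_ltn_trans (lt_size_deriv P0); apply: dvdp_leq => //; exact: dvdp_gcdr.
have sG1 : (1 < size G)%N.
  move: ncop; rewrite /coprimep -/G; have : (0 < size G)%N by rewrite size_poly_gt0.
  by lia.
have PG : P = P %/ G * G by rewrite divpK ?dvdp_gcdl.
move: rP; rewrite PG rmorphM rootM => /orP[rR|rG]; last exact: small rG sG.
apply: (small (P %/ G)) rR _.
  by apply: contraNneq P0 => e; rewrite PG e mul0r.
rewrite size_divp //; move: (size P) (size G) s1 sG1 => k1 k2; clear; lia.
Qed.

End SubstitutionMorphism.

Lemma separable_quotientP (n d : {poly K}) : d != 0 -> let g := frac n / frac d in
  (forall z, exists P : {poly T},
    [/\ forall i, exists u v : {poly K}, evalf v g != 0 /\ P`_i = evalf u g / evalf v g,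
        separable_poly P & root P z]) <-> n^`() * d - n * d^`() != 0.
Proof.
move=> d0 g; have [p _ pK] := finPcharP K.
have t0 : frac d != 0 by rewrite frac_eq0.
have dg : (deriv_frac g != 0) = (n^`() * d - n * d^`() != 0).
  rewrite deriv_fracE // -!rmorphM -rmorphB mulf_eq0 invr_eq0 frac_eq0.
  by rewrite expf_eq0 (negPf t0) orbF.
rewrite -dg; split=> [sep|dg0].
  apply/eqP => dg0; have [P [hP sP rP]] := sep (frac 'X).
  apply: (inseparable_root dg0 _ hP rP sP).
  by rewrite deriv_frac_poly derivX rmorph1 oner_eq0.
move=> z; have [P [sP rP]] := separable_over_subst pK dg0 z.
exists (map_poly (subst_frac g) P); split=> // i.
have s0 : subst_frac g 0 = 0.
  by have := subst_frac_poly pK dg0 0; rewrite rmorph0 /evalf map_poly0 horner0.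
rewrite coef_map_id0 //.
exists (num P`_i), (den P`_i); split=> //.
exact: (evalf_neq0 pK dg0).
Qed.

End Separability.

Lemma rat_separableP (K : finFieldType) (n d : {poly K}) : d != 0 ->
  rat_separable (tofrac n / tofrac d) <-> n^`() * d - n * d^`() != 0.
Proof.
apply: (@separable_quotientP K {fraction {poly K}} (@tofrac _)
  (fun f => \n_(repr f)) (fun f => \d_(repr f))) => [P Q /eqP|f|f].
- by rewrite tofrac_eq => /eqP.
- exact: denom_ratioP.
- by have d0 := denom_ratioP (repr f); rewrite /= repr_fraction mulfK // tofrac_eq0.
Qed.

(** * The two criteria *)

Section Criteria.
Variables (F : finFieldType) (s : {rmorphism F -> F}) (q : nat).
Hypothesis sK : involutive s.
Hypothesis sE : forall x, s x = x ^+ q.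
Variables a b c d : F.

Let expq1 x : x ^+ (q + 1) = x * s x.
Proof. by rewrite exprD expr1 mulrC sE. Qed.

Let exp2q x : x ^+ (2 * q) = s x ^+ 2.
Proof. by rewrite mulnC exprM sE. Qed.

Let char2 : (2%N \in [pchar F]) = (2 == 0 :> F).
Proof. by rewrite inE. Qed.

(** Both alternatives of (I.a) say that there are A and B with the same relations to
    the minors; they differ in whether A, and hence the minor that would define B, is
    zero. *)
Lemma criterion_IaP : criterion_Ia q a b c d <-> exists A B,
  let M := b * s d - a * s c in
  [/\ M != 0 /\ (2 = 0 :> F -> A != 0), c * s d - a * s b = A * M,
      s c * d - s a * b = A * B * M,
      c * s c - b * s b + 3 * (d * s d - a * s a) = (A ^+ 2 + 2 * B) * M &
      s b * d - s a * c = B ^+ 2 * M].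
Proof.
rewrite /criterion_Ia !expq1 -!sE -subr_eq0 char2.
set M := b * s d - a * s c; set L := c * s d - a * s b.
split=> [[M0 [[L0 eS eT]|[L0 two eT]]] | [A [B [[M0 two] eL esL eS eT]]]].
- have {}L0 : L != 0 by rewrite subr_eq0.
  exists (L / M), ((s c * d - s a * b) / L); split.
  + by split=> // _; rewrite mulf_neq0 ?invr_eq0.
  + by rewrite divfK.
  + by fld.
  + by rewrite eS divfK //; ring.
  + by rewrite eT divfK.
- have {}L0 : L = 0 by rewrite /L L0 subrr.
  have esL : s c * d - s a * b = 0.
    by have := congr1 s L0; rewrite rmorphB !rmorphM !sK rmorph0.
  have M2 : 2 * M != 0 by rewrite mulf_neq0.
  exists 0, ((c * s c - b * s b + 3 * (d * s d) - 3 * (a * s a)) / (2 * M)); split.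
  + by split=> // e; case/eqP: two; rewrite e.
  + by rewrite L0 mul0r.
  + by rewrite esL !mul0r.
  + by fld.
  + by rewrite eT divfK.
have eA : L / M = A by rewrite eL mulfK.
split=> //; have [A0|A0] := eqVneq A 0.
  right; have two0 : 2 != 0 :> F by apply/eqP => /two; rewrite A0 eqxx.
  split=> //; first by apply/eqP; rewrite -subr_eq0 -/L eL A0 mul0r.
  rewrite (_ : (_ / (2 * M)) = B) ?eT ?mulfK //.
  apply: (mulIf (mulf_neq0 two0 M0)); rewrite divfK ?mulf_neq0 //.
  by apply: (lin_eq eS); rewrite A0; ring.
left; have L0 : L != 0 by rewrite eL mulf_neq0.
have eB : (s c * d - s a * b) / L = B.
  by rewrite esL eL; fld.
rewrite eA eB; split.
- by rewrite -subr_eq0.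
- by apply: (mulIf M0); rewrite divfK // -eS; ring.
- by rewrite eT mulfK.
Qed.

(** Up to sign, Q(t) is the leading coefficient of the Hessian of the cubic N - t D. *)
Lemma root_polyQ t : 2 != 0 :> F -> root (polyQ q a b c d) t =
  (3 * (s d - t * a) * (s b - t * c) - (s c - t * b) ^+ 2 == 0).
Proof.
move=> two; rewrite /polyQ char2 (negPf two) exp2q -!sE rootE !hornerE /=.
by congr (_ == 0); ring.
Qed.

(** In characteristic two Q(t) is the middle coefficient of that Hessian instead. *)
Lemma root_polyQ2 t : 2 = 0 :> F -> root (polyQ q a b c d) t =
  ((s d - t * a) * (s a - t * d) + (s c - t * b) * (s b - t * c) == 0).
Proof.
move=> two; rewrite /polyQ char2 two eqxx !expq1 -!sE rootE !hornerE /=.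
congr (_ == 0); apply: (lin_eq (eqM (t * (a * s a + b * s b + c * s c + d * s d)) two)).
ring.
Qed.

Hypothesis q_gt1 : (1 < q)%N.

Let mu_root x : (q.+1).-unity_root x <-> unitary s x.
Proof. by rewrite (unitaryE sE); split=> [/unity_rootP|/unity_rootP]. Qed.

(** As gcd(3, q - 1) = 1 and 3 does not divide q, it divides q + 1, so only the first
    alternative of (I.b) can hold. *)
Lemma criterion_I_injective : 3 != 0 :> F -> gcdn 3 (q - 1) = 1%N ->
  ~~ (3 %| q)%N -> only_trivial_cube_root s ->
  (forall A B, d * s d - a * s a = B * (b * s d - a * s c) ->
     c * s d - a * s b = A * (b * s d - a * s c) ->
     s c * d - s a * b = A * B * (b * s d - a * s c) ->
     c * s c - b * s b + 3 * (d * s d - a * s a) = (A ^+ 2 + 2 * B) * (b * s d - a * s c) ->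
     b * s d - a * s c <> 0 -> False) ->
  criterion_I q a b c d -> injective_on_unitary s a b c d.
Proof.
move=> n3 hg n3q cub nd [/criterion_IaP[A [B [[M0 two] eL esL eS eT]]] hb].
have pi0 : d * s d - a * s a != B * (b * s d - a * s c).
  by apply/eqP => e; apply: (nd A B) => //; apply/eqP.
case: hb => [[_ [t /mu_root ut rt]]|[hg' _]]; last first.
  have n3q1 : ~~ (3 %| q - 1)%N by apply/negP => /gcdn_idPl; rewrite hg.
  have /gcdn_idPl : (3 %| q + 1)%N by move: n3q n3q1 q_gt1; lia.
  by rewrite hg'.
apply: (cube_pencil_injective sK n3 cub M0 eL esL eS eT pi0 ut).
have [hc hd hc' hd'] := pencil_of_minors M0 eL esL eS eT pi0.
have k1 : s b - t * c = (s c - t * b) * A - 3 * (s d - t * a) * B.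
  by apply: (lin_eq (eqD hc' (eqM (-t) hc))); ring.
have k0 : 3 * (s a - t * d) = (s c - t * b) * (A ^+ 2 - B) - 3 * (s d - t * a) * A * B.
  by apply: (lin_eq (eqD hd' (eqM (-t) hd))); ring.
have [two0|two0] := eqVneq (2 : F) 0; last first.
  move: rt; rewrite root_polyQ // k1 => /eqP rt; apply: (lin_eq (eqM (-1) rt)); ring.
have A0 := two two0; move: rt; rewrite root_polyQ2 // => /eqP rt.
apply: (mulfI A0); rewrite mulr0.
move: k0 k1 rt; move: (s d - t * a) (s c - t * b) (s b - t * c) (s a - t * d).
move=> c3 c2 c1 c0 k0 k1 rt.
(* in characteristic two the leading factors 3 and 9 are 1 *)
apply: (lin_eq (eqD rt (eqD (eqD (eqM (- c3) k0) (eqM (- c2) k1))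
   (eqM (c3 * c0 - 2 * A ^+ 2 * c2 * c3 + 2 * B * c2 * c3 + 6 * A * B * c3 ^+ 2) two0)))).
ring.
Qed.


Lemma criterion_I_of_ramification u t l v t' l' : 3 != 0 :> F ->
  gcdn 3 (q - 1) = 1%N -> nonvanishing s a b c d -> injective_on_unitary s a b c d ->
  unitary s u -> unitary s v -> u != v ->
  totally_ramified s a b c d u t l -> totally_ramified s a b c d v t' l' ->
  criterion_I q a b c d.
Proof.
move=> n3 hg nv inj uu uv neq tr tr'; split.
  have [M0 eL esL eS eT] := two_cubes_minors n3 inj uu uv neq tr tr'.
  apply/criterion_IaP; exists (- (u + v)), (u * v); split=> //; split=> // two.
  apply: contraNneq neq => e; apply/eqP.
  by apply: (lin_eq (eqD (eqM (-1) e) (eqM (- v) two))); ring.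
left; split=> //; exists t.
  by apply/mu_root; exact: branch_value_unitary nv uu tr.
case: tr => h3 h2 h1 h0.
have [two|two] := eqVneq (2 : F) 0.
  rewrite root_polyQ2 // h3 h2 h1 h0; apply/eqP.
  by apply: (lin_eq (eqM (- 5 * l ^+ 2 * u ^+ 3) two)); ring.
by rewrite root_polyQ // h3 h2 h1; apply/eqP; ring.
Qed.

Section Char3.
Hypothesis char3 : 3 = 0 :> F.

(** A square root y of - k w ^ 2 in the fixed field corresponds to De = y / w. *)
Lemma nonsquare_line al w k : unitary s al -> w != 0 -> s w = - w / al ^+ 2 ->
  k != 0 -> s k = al ^+ 4 * k ->
  nonsquare_Fq q (- k * w ^+ 2) <->
  forall De, De != 0 -> s De = - al ^+ 2 * De -> k + De ^+ 2 != 0.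
Proof.
move=> ua w0 sw k0 sk; have a0 := unitary_neq0 ua.
have z0 : - k * w ^+ 2 != 0 by rewrite mulf_neq0 ?oppr_eq0 ?expf_neq0.
split=> [[_ _ ns] De De0 sDe | no].
  apply/eqP => e; apply: ns; exists (De * w).
    by rewrite /in_Fq -sE rmorphM sDe sw; fld.
  by apply: (lin_eq (eqM (w ^+ 2) e)); ring.
split=> // [|[y]].
  by rewrite /in_Fq -sE rmorphM rmorphN rmorphXn /= sk sw; fld.
rewrite /in_Fq -sE => sy ey.
have y0 : y != 0 by apply: contraNneq z0 => y0; rewrite -ey y0 expr0n.
have sw0 : s w != 0 by rewrite fmorph_eq0.
have e : k + (y / w) ^+ 2 == 0 by rewrite expr_div_n ey; apply/eqP; fld.
move: e; apply/negP; apply: no; first by rewrite mulf_neq0 ?invr_eq0.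
by rewrite fmorph_div sy sw; fld.
Qed.

Variables (gamma al t e0 : F).
Hypotheses (ug : unitary s gamma) (g_neq : s gamma != gamma).
Hypotheses (ua : unitary s al) (ut : unitary s t) (b0 : b != 0).
Hypotheses (cE : c = al * b) (scE : s c = t * b) (sbE : s b = al * t * b).
Hypotheses (De0 : cform a b c d al 1 = e0)
           (Ne0 : cform (s d) (s c) (s b) (s a) al 1 = t * e0).

Let isolated := forall De, De != 0 -> s De = - al ^+ 2 * De -> b + e0 * De ^+ 2 != 0.

Let se0 : s e0 = t * e0 / al ^+ 3.
Proof.
have a0 := unitary_neq0 ua; apply: (mulIf (expf_neq0 3 a0)).
by rewrite divfK ?expf_neq0 // -Ne0 cform_conj // De0 mulrC.
Qed.

(** All four quotients of criterion (II) have this shape, for x one of beta, alpha,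
    gamma: the factor x - s x cancels and - (b / e0) W is left. *)
Lemma quotient_nonsquare x w W : unitary s x -> s x != x -> w != 0 ->
  s w = - w / al ^+ 2 -> W = w ^+ 2 ->
  nonsquare_quotient q (t * s x * (b * W) - x * (t * b * W))
     (x * (t * e0) - t * s x * e0) <-> e0 != 0 /\ isolated.
Proof.
move=> ux xs w0 sw ->; have t0 := unitary_neq0 ut; have a0 := unitary_neq0 ua.
have xs0 : x - s x != 0 by rewrite subr_eq0 eq_sym.
have -> : x * (t * e0) - t * s x * e0 = t * e0 * (x - s x) by ring.
have e0P : (t * e0 * (x - s x) != 0) = (e0 != 0).
  by rewrite !mulf_eq0 (negPf t0) (negPf xs0) orbF.
rewrite /nonsquare_quotient e0P.
have [e00|e00] := eqVneq e0 0; first by split=> -[].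
have k0 : b / e0 != 0 by rewrite mulf_neq0 ?invr_eq0.
have sk : s (b / e0) = al ^+ 4 * (b / e0) by rewrite fmorph_div sbE se0; fld.
have -> : (t * s x * (b * w ^+ 2) - x * (t * b * w ^+ 2)) / (t * e0 * (x - s x)) =
    - (b / e0) * w ^+ 2.
  by move: (s x) xs0 {xs} => y xs0; fld.
rewrite (nonsquare_line ua w0 sw k0 sk).
have iso De : (b + e0 * De ^+ 2 != 0) = (b / e0 + De ^+ 2 != 0).
  have -> : b + e0 * De ^+ 2 = e0 * (b / e0 + De ^+ 2) by fld.
  by rewrite mulf_eq0 (negPf e00).
split=> -[_ h]; split=> // De De1 De2; first by rewrite iso; apply: h.
by rewrite -iso; apply: h.
Qed.

Let unitary_expq1 x : unitary s x -> x ^+ (q - 1) = x^-1 ^+ 2.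
Proof.
move=> ux; have x0 := unitary_neq0 ux; apply: (mulIf x0).
by rewrite -exprSr subn1 prednK ?(ltnW q_gt1) // -sE (unitary_conj ux); fld.
Qed.

Let sqrt_generic : s al != al -> let w := 1 - al ^+ 2 in w != 0 /\ s w = - w / al ^+ 2.
Proof.
move=> aa w; have a0 := unitary_neq0 ua; split.
  rewrite subr_eq0; apply: contraNneq aa => e.
  by apply/eqP; apply: (mulfI a0); rewrite ua -expr2.
by rewrite /w rmorphB rmorph1 rmorphXn /= (unitary_conj ua); fld.
Qed.

Let sqrt_special x : s al = al -> unitary s x -> s x != x ->
  let w := x - x^-1 in w != 0 /\ s w = - w / al ^+ 2.
Proof.
move=> aa ux xx w; have x0 := unitary_neq0 ux.
have al2 : al ^+ 2 = 1 by rewrite expr2 -{2}aa.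
split; first by rewrite subr_eq0 -(unitary_conj ux) eq_sym.
by rewrite al2 divr1 /w rmorphB fmorphV /= (unitary_conj ux) invrK opprB.
Qed.

Let A3E u v : s c * u + s b * v = t * b * (u + al * v).
Proof. by rewrite scE sbE; ring. Qed.
Let B3E u v : b * u + c * v = b * (u + al * v).
Proof. by rewrite cE; ring. Qed.

Let W_generic : 2 * al ^+ 2 + 1 + al * (2 * al + al ^+ 3) = (1 - al ^+ 2) ^+ 2.
Proof. by apply: (lin_eq (eqM (2 * al ^+ 2) char3)); ring. Qed.

Let W_special x : s al = al -> unitary s x ->
  2 * al ^+ 2 + al ^+ 2 * x ^+ (q - 1) + al * (2 * al + al * x ^+ 2) = (x - x^-1) ^+ 2.
Proof.
move=> aa ux; have al2 : al ^+ 2 = 1 by rewrite expr2 -{2}aa.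
have x0 := unitary_neq0 ux; rewrite unitary_expq1 //.
have -> : 2 * al ^+ 2 + al ^+ 2 * x^-1 ^+ 2 + al * (2 * al + al * x ^+ 2) =
  al ^+ 2 * (4 + x^-1 ^+ 2 + x ^+ 2) by ring.
rewrite al2 mul1r.
by apply: (lin_eq (eqM 2 char3)); fld.
Qed.

(** The case distinction of the criterion serves to choose w with w ^ (q - 1) equal to
    - al ^ -2 and x with s x distinct from x; all four cases express the same
    condition. *)
Lemma criterion_II_cases :
  [\/ [/\ ~ in_Fq q al, ~ in_Fq q t
       & let u := 2 * al ^+ 2 + 1 in let v := 2 * al + al ^+ 3 in
         nonsquare_quotient q (b * u + c * v - t * (s c * u + s b * v)) (t * (t * e0) - e0)],
      [/\ ~ in_Fq q al, in_Fq q t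
       & let u := 2 * al ^+ 2 + 1 in let v := 2 * al + al ^+ 3 in
         nonsquare_quotient q (t * s al * (b * u + c * v) - al * (s c * u + s b * v))
           (al * (t * e0) - t * s al * e0)],
      [/\ in_Fq q al, ~ in_Fq q t
       & let u := 2 * al ^+ 2 + al ^+ 2 * t ^+ (q - 1) in
         let v := 2 * al + al * t ^+ 2 in
         nonsquare_quotient q (b * u + c * v - t * (s c * u + s b * v)) (t * (t * e0) - e0)]
    | [/\ in_Fq q al, in_Fq q t
       & let u := 2 * al ^+ 2 + al ^+ 2 * gamma ^+ (q - 1) in
         let v := 2 * al + al * gamma ^+ 2 in
         nonsquare_quotient q (t * s gamma * (b * u + c * v) - gamma * (s c * u + s b * v))
           (gamma * (t * e0) - t * s gamma * e0)]] <-> e0 != 0 /\ isolated.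
Proof.
rewrite /in_Fq -!sE /=.
have t_case W : nonsquare_quotient q (b * W - t * (t * b * W)) (t * (t * e0) - e0) =
    nonsquare_quotient q (t * s t * (b * W) - t * (t * b * W)) (t * (t * e0) - t * s t * e0).
  by rewrite ut !mul1r.
rewrite !A3E !B3E !t_case W_generic.
split.
  case=> [[/eqP aa /eqP tt]|[/eqP aa tt]|[aa /eqP tt]|[aa tt]].
  - by have [w0 sw] := sqrt_generic aa; rewrite (quotient_nonsquare ut tt w0 sw).
  - by have [w0 sw] := sqrt_generic aa; rewrite (quotient_nonsquare ua aa w0 sw).
  - rewrite W_special //; have [w0 sw] := sqrt_special aa ut tt.
    by rewrite (quotient_nonsquare ut tt w0 sw).
  - rewrite W_special //; have [w0 sw] := sqrt_special aa ug g_neq.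
    by rewrite (quotient_nonsquare ug g_neq w0 sw).
move=> h; have [aa|aa] := eqVneq (s al) al; have [tt|tt] := eqVneq (s t) t.
- apply: Or44; split=> //; rewrite W_special //; have [w0 sw] := sqrt_special aa ug g_neq.
  by rewrite (quotient_nonsquare ug g_neq w0 sw).
- apply: Or43; split=> //; first by apply/eqP.
  rewrite W_special //; have [w0 sw] := sqrt_special aa ut tt.
  by rewrite (quotient_nonsquare ut tt w0 sw).
- apply: Or42; split=> //; first by apply/eqP.
  by have [w0 sw] := sqrt_generic aa; rewrite (quotient_nonsquare ua aa w0 sw).
- apply: Or41; split; try exact/eqP.
  by have [w0 sw] := sqrt_generic aa; rewrite (quotient_nonsquare ut tt w0 sw).
Qed.

End Char3.

Section CriterionII.
Variable gamma : F.
Hypotheses (char3 : 3 = 0 :> F) (ug : unitary s gamma) (g_neq : s gamma != gamma).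

(** The equations on alpha and beta say that al is totally ramified and that g has no
    other ramification. *)
Lemma criterion_IIP : criterion_II q gamma a b c d <->
  exists al t e0, [/\ unitary s al, unitary s t & b != 0] /\
    [/\ c = al * b, s c = t * b & s b = al * t * b] /\
    [/\ b * s d != a * s c, cform a b c d al 1 = e0, cform (s d) (s c) (s b) (s a) al 1 = t * e0,
       e0 != 0 & forall De, De != 0 -> s De = - al ^+ 2 * De -> b + e0 * De ^+ 2 != 0].
Proof.
rewrite /criterion_II -!sE.
set M := b * s d - a * s c; set al := (c * s d - a * s b) / M; set t := s c / b.
set A1 := s d * al ^+ 3 + s c * al ^+ 2 + s b * al + s a.
set B1 := a * al ^+ 3 + b * al ^+ 2 + c * al + d.
have A1E : A1 = cform (s d) (s c) (s b) (s a) al 1 by rewrite /A1 /cform; ring.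
have B1E : B1 = cform a b c d al 1 by rewrite /B1 /cform; ring.
split=> [[M0 al3 /mu_root ua [b0 /mu_root ut] cases] |
  [al' [t' [e0 [[ua ut b0] [[cE scE sbE] [M0 De0 Ne0 e00 iso]]]]]]].
  have M0' : M != 0 by rewrite subr_eq0.
  have hL : c * s d - a * s b = al * M by rewrite divfK.
  have hsL : s c * d - s a * b = al ^+ 3 * M by rewrite al3 divfK.
  have scE : s c = t * b by rewrite divfK.
  have p21 : c * s c - b * s b = 0.
    have ect : c = s t * s b by have := congr1 s scE; rewrite sK rmorphM.
    rewrite {1}ect scE; apply: (lin_eq (eqM (b * s b) ut)); ring.
  have cE : c = al * b.
    apply: (mulIf M0'); apply: (lin_eq (eqD (eqM b hL) (eqM (-a) p21))); rewrite /M; ring.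
  have sbE : s b = al * t * b.
    rewrite -mulrA -scE.
    apply: (mulIf M0'); apply: (lin_eq (eqD (eqM (s c) hL) (eqM (- s d) p21))); rewrite /M; ring.
  have NE : cform (s d) (s c) (s b) (s a) al 1 = t * cform a b c d al 1.
    apply: (mulIf b0); rewrite mulrAC -scE.
    (* the value of the third minor says that N and t D agree at al *)
    apply: (lin_eq (eqD (eqM (-1) hsL) (eqM (- al) p21))).
    by rewrite /cform /M; ring.
  exists al, t, (cform a b c d al 1); split=> //; split=> //.
  move: cases; rewrite A1E B1E NE.
  move/(criterion_II_cases char3 ug g_neq ua ut b0 cE scE sbE (erefl _) NE).
  by case.
have M0' : M != 0 by rewrite subr_eq0.
have hL : c * s d - a * s b = al' * M.
  apply: (lin_eq (eqD (eqM (s d) cE) (eqD (eqM (- a) sbE) (eqM (a * al') scE)))).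
  by rewrite /M; ring.
have alE : al = al' by rewrite /al hL mulfK.
have tE : t = t' by rewrite /t scE mulfK.
have hsL : s c * d - s a * b = al' ^+ 3 * M.
  have p21 : c * s c - b * s b = 0 by rewrite {1}cE sbE scE; ring.
  have e : cform (s d) (s c) (s b) (s a) al' 1 * b = s c * cform a b c d al' 1.
    by rewrite Ne0 De0 scE; ring.
  apply: (lin_eq (eqD (eqM (-1) e) (eqM (- al') p21))).
  by rewrite /cform /M; ring.
rewrite hsL mulfK // A1E B1E alE tE Ne0 De0; split=> //; first exact/mu_root.
  by split=> //; apply/mu_root.
by apply/(criterion_II_cases char3 ug g_neq ua ut b0 cE scE sbE De0 Ne0).
Qed.
End CriterionII.
End Criteria.

(** * The classification *)

Section Wronskian.
Variable F : fieldType.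
Variables n3 n2 n1 n0 a b c d : F.

(** The coefficients are the minors that also describe the pencil of the two cubics. *)
Lemma wronskian_polyD :
  (polyD n3 n2 n1 n0)^`() * polyD a b c d - polyD n3 n2 n1 n0 * (polyD a b c d)^`() =
  (n3 * b - n2 * a)%:P * 'X^4 + (2 * (n3 * c - n1 * a))%:P * 'X^3 +
  (n2 * c - n1 * b + 3 * (n3 * d - n0 * a))%:P * 'X^2 +
  (2 * (n2 * d - n0 * b))%:P * 'X + (n1 * d - n0 * c)%:P.
Proof.
rewrite /polyD !derivD !derivZ !derivXn derivX !derivC /= expr1 -!mul_polyC.
rewrite !(polyCD, polyCN, polyCM) ?polyC_natr ?polyC1.
ring.
Qed.

Lemma char3_wronskian_eq0 : 3 = 0 :> F ->
  (polyD n3 n2 n1 n0)^`() * polyD a b c d - polyD n3 n2 n1 n0 * (polyD a b c d)^`() = 0 ->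
  [/\ n3 * b = n2 * a, n3 * c = n1 * a, n2 * c = n1 * b, n2 * d = n0 * b & n1 * d = n0 * c].
Proof.
move=> c3; rewrite wronskian_polyD => /polyP e.
have two : 2 != 0 :> F.
  apply/eqP => two; case/eqP: (oner_neq0 F); apply: (lin_eq (eqD c3 (eqM (-1) two))); ring.
have qE := e 4%N; have h3 := e 3%N; have h2 := e 2%N; have h1 := e 1%N; have h0 := e 0%N.
rewrite !coefD !coefCM !coefXn !coefX !coefC /= in qE h3 h2 h1 h0.
split.
- by apply: (lin_eq qE); ring.
- by apply: (mulfI two); apply: (lin_eq h3); ring.
- by apply: (lin_eq (eqD h2 (eqM (- (n3 * d - n0 * a)) c3))); ring.
- by apply: (mulfI two); apply: (lin_eq h1); ring.
- by apply: (lin_eq h0); ring.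
Qed.

End Wronskian.

Theorem theorem8 (p m : nat) (hp : prime p) (hm : (0 < m)%N)
    (F : finFieldType) (hF : #|F| = ((p ^ m) ^ 2)%N)
    (gamma : F) (hgamma : ((p ^ m).+1).-primitive_root gamma)
    (a b c d : F)
    (habcd : ~ [/\ a = 0, b = 0, c = 0 & d = 0]) :
  let q := (p ^ m)%N in
  let D := polyD a b c d in
  let N := polyN q a b c d in
  let g := rat_g q a b c d in
  permutation_poly (poly_h q a b c d) <->
  gcdn 3 (q - 1) = 1%N /\
  [\/ [/\ rat_degree g = 3%N, 3%N \notin [pchar F] & criterion_I q a b c d],
      [/\ rat_separable g, rat_degree g = 3%N, 3%N \in [pchar F]
        & criterion_II q gamma a b c d],
      [/\ rat_degree g = 3%N, 3%N \in [pchar F], ~ rat_separable g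
        & d ^+ (q + 1) != a ^+ (q + 1)]
    | rat_degree g = 1%N /\ ~ has_root_in_mu q (gcdp D N)].
Proof.
move=> q D N g.
have q_gt1 : (1 < q)%N.
  by rewrite /q -(prednK hm) expnS (leq_trans (prime_gt1 hp)) // leq_pmulr // expn_gt0 prime_gt0.
have pF : p \in [pchar F] by apply: (@card_finPcharP _ _ (m * 2)) => //; rewrite expnM.
have q0 : q%:R = 0 :> F.
  by rewrite /q natrX (pcharf0 pF) expr0n gtn_eqF.
have [s sE] : exists s : {rmorphism F -> F}, forall x, s x = x ^+ q := frobenius_power m pF.
have sK : involutive s by move=> x; rewrite !sE -exprM mulnn -hF expf_card.
have qE : q = (p ^ m)%N by [].
have ug : unitary s gamma := unitary_gamma sE hgamma.
have u1 : unitary s 1 := unitary1 s.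
have g1 : gamma != 1 := gamma_neq1 q_gt1 hgamma.
have g_neq : s gamma != gamma.
  rewrite (unitary_conj ug); apply/eqP => e; have g0 := unitary_neq0 ug.
  have : gamma ^+ 2 == 1 by rewrite expr2 -{1}e mulVf.
  by rewrite -(prim_order_dvd hgamma) gtnNdvd.
have c3E : (3%N \in [pchar F]) = (3 == 0 :> F) by rewrite inE.
have D0 : D != 0 by apply/eqP => /polyD_eq0.
have NE : N = polyD (s d) (s c) (s b) (s a) by rewrite /N (polyN_polyD sE).
have sepP : rat_separable g <-> N^`() * D - N * D^`() != 0 := rat_separableP N D0.
have rootP x : (q.+1).-unity_root x <-> unitary s x.
  by rewrite (unitaryE sE); split=> [/unity_rootP|/unity_rootP].
have Hroot : ~ has_root_in_mu q (gcdp D N) <-> forall x, unitary s x -> ~~ root (gcdp N D) x.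
  have gE x : root (gcdp N D) x = root (gcdp D N) x by rewrite !root_gcd andbC.
  split=> [no x ux|no [x /rootP ux rx]].
    by apply/negP => rx; apply: no; exists x; [exact/rootP | rewrite -gE].
  by have := no x ux; rewrite gE rx.
have expq1 x : x ^+ (q + 1) = x * s x by rewrite exprD expr1 mulrC sE.
have -> : permutation_poly (poly_h q a b c d) <->
    [/\ gcdn 3 (q - 1) = 1%N, nonvanishing s a b c d & injective_on_unitary s a b c d].
  exact: (permutation_polyP sK sE q_gt1 hF hgamma).
split=> [[hg nv inj]|[hg cases]].
  split=> //; have [deg|deg] := permuting_degree sK sE habcd ug g1 nv inj; last first.
    apply: Or44; split=> //; apply/Hroot.
    by apply/(degree1_permuting sE habcd deg).
  have cop := degree3_no_common_root sE habcd deg.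
  have [om uom omE] := cube_root_exists sE q_gt1 hF hgamma hp pF qE hg.
  have [c3|c3] := eqVneq (3 : F) 0; last first.
    apply: Or41; rewrite c3E (negPf c3); split=> //.
    have [u [t [l [v [t' [l' [uu uv neq tr tr']]]]]]] :=
      two_ramification_points sK sE q_gt1 q0 hF hgamma uom omE pF qE hg nv inj cop c3.
    exact: (criterion_I_of_ramification sK sE c3 hg nv inj uu uv neq tr tr').
  have [al [t [l [ua tr]]]] :=
    ramification_point_exists sK sE q_gt1 q0 hF hgamma uom omE pF qE hg nv inj cop.
  have de0 : gamma - s gamma != 0 by rewrite subr_eq0 eq_sym.
  have sde : s (gamma - s gamma) = - (gamma - s gamma) by rewrite rmorphB /= sK opprB.
  have ex : exists2 x, unitary s x & x != al.
    by have [e|ne] := eqVneq al 1; [exists gamma; rewrite // e | exists 1; rewrite // eq_sym].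
  have [cE l0 sbE iso] := char3_shape sK c3 nv inj ua tr de0 sde ex.
  have scE : s c = t * b.
    by case: tr => _ h2 _ _; apply: (lin_eq (eqD h2 (eqM (- l * al) c3))); ring.
  have [w0|w0] := eqVneq (N^`() * D - N * D^`()) 0.
    apply: Or43; rewrite c3E c3 eqxx; split=> //.
      by move/sepP; rewrite w0 eqxx.
    rewrite !expq1; apply: contraNneq g1 => e; apply/eqP; apply: inj => //.
    rewrite NE in w0; have [m1 m2 m3 m4 m5] := char3_wronskian_eq0 c3 w0.
    apply: (lin_eq (eqD (eqD (eqM (gamma ^+ 2 * (gamma - 1)) m1)
         (eqM ((gamma - 1) * (gamma ^+ 2 + gamma)) m2))
       (eqD (eqM (gamma * (gamma - 1)) m3) 
         (eqD (eqM (gamma ^+ 2 - 1) m4) (eqD (eqM (gamma - 1) m5) (eqM (gamma ^+ 3 - 1) e)))))).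
    by rewrite /cform; ring.
  apply: Or42; rewrite c3E c3 eqxx; split=> //; first by apply/sepP.
  have b0 : b != 0.
    apply: contraNneq w0 => b0; apply/eqP.
    have c0 : c = 0 by rewrite cE b0 mulr0.
    rewrite NE /D wronskian_polyD b0 c0 c3 rmorph0 !(mulr0, mul0r, subr0, addr0, polyC0).
    by [].
  apply/(criterion_IIP sK sE a b c d q_gt1 c3 ug g_neq).
  have ut := branch_value_unitary sK nv ua tr.
  exists al, t, (cform a b c d al 1); split=> //; split=> //; split=> //.
  - rewrite -subr_eq0; have -> : b * s d - a * s c = b * l.
      by case: tr => h3 _ _ _; apply: (lin_eq (eqD (eqM b h3) (eqM (- a) scE))); ring.
    by rewrite mulf_neq0.
  - by rewrite (totally_ramifiedP al tr) subrr expr0n mulr0 addr0.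
  - exact: (nv _ ua).
suff [nv inj] : nonvanishing s a b c d /\ injective_on_unitary s a b c d by [].
case: cases => [[deg]|[_ deg]|[deg]|[deg /Hroot hr]].
- rewrite c3E => c3 crit.
  have nv := degree3_nonvanishing sE habcd deg; split=> //.
  apply: (criterion_I_injective sK sE q_gt1 c3 hg _ _ _ crit).
  + rewrite /q Euclid_dvdX // dvdn_prime2 //; apply/negP => /andP[/eqP e _].
    by case/eqP: c3; rewrite e; apply: pcharf0.
  + move=> x sx x3; apply: (fixed_cube sE q_gt1 hg _ sx).2 => //.
    by apply: contraTneq isT => x0; move: x3; rewrite x0 expr0n => /eqP; rewrite eq_sym oner_eq0.
  move=> A B ep eL esL eS /eqP M0; set M := b * s d - a * s c in ep eL esL eS M0.
  (* the cubics N and D share the factor x^2 + A x + B *)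
  have e21 : c * s c - b * s b = (A ^+ 2 - B) * M.
    by apply: (lin_eq (eqD eS (eqM (-3) ep))); ring.
  have ec : c = b * A - a * (A ^+ 2 - B).
    by apply: (mulIf M0); apply: (lin_eq (eqD (eqM b eL) (eqM (-a) e21))); rewrite /M; ring.
  have ed : d = b * B - a * A * B.
    by apply: (mulIf M0); apply: (lin_eq (eqD (eqM b ep) (eqM (-a) esL))); rewrite /M; ring.
  have esb : s b = s c * A - s d * (A ^+ 2 - B).
    by apply: (mulIf M0); apply: (lin_eq (eqD (eqM (s c) eL) (eqM (- s d) e21))); rewrite /M; ring.
  have esa : s a = s c * B - s d * A * B.
    by apply: (mulIf M0); apply: (lin_eq (eqD (eqM (s c) ep) (eqM (- s d) esL))); rewrite /M; ring.
  have dv x y : 'X^2 + A *: 'X + B%:P %| polyD x y (y * A - x * (A ^+ 2 - B)) (y * B - x * A * B).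
    apply/dvdpP; exists (x *: 'X + (y - x * A)%:P).
    by rewrite /polyD -!mul_polyC !(polyCD, polyCN, polyCM); ring.
  apply: (degree3_no_quadratic_factor sE habcd (A := A) (B := B) deg).
    by rewrite ec ed.
  by rewrite (polyN_polyD sE) esb esa.
- rewrite c3E => /eqP c3 /(criterion_IIP sK sE a b c d q_gt1 c3 ug g_neq).
  move=> [al [t [e0 [[ua ut b0] [[cE scE sbE] [M0 De0 Ne0 e00 iso]]]]]].
  have nv := degree3_nonvanishing sE habcd deg; split=> //.
  apply: (@char3_injective _ s c3 a b c d al (e0 / b)) => //.
  + by rewrite sbE scE; ring.
  + rewrite divfK // -De0.
    apply: (lin_eq (eqD (eqM (- al) cE) (eqM (- al ^+ 2 * b) c3))); rewrite /cform; ring.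
  + have -> : e0 / b * s c = t * e0 by rewrite scE; fld.
    rewrite -Ne0; apply: (lin_eq (eqD (eqM (- al) sbE)
      (eqD (eqM (- 2 * al ^+ 2) scE) (eqM (- al ^+ 2 * t * b) c3)))).
    by rewrite /cform; ring.
  + by rewrite mulf_neq0 ?invr_eq0.
  move=> De Dn sDe; have := iso De Dn sDe.
  have -> : b + e0 * De ^+ 2 = b * (1 + e0 / b * De ^+ 2) by fld.
  by rewrite mulf_eq0 (negPf b0).
- rewrite c3E => /eqP c3 nsep; rewrite !expq1 -subr_eq0 => p30.
  have nv := degree3_nonvanishing sE habcd deg; split=> //.
  have w0 : N^`() * D - N * D^`() = 0.
    by apply/eqP; apply: contraT => w; case: nsep; apply/sepP.
  rewrite NE in w0; have [m1 m2 m3 m4 m5] := char3_wronskian_eq0 c3 w0.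
  move=> x y ux uy e.
  suff : (x - y) ^+ 3 == 0 by rewrite expf_eq0 subr_eq0 => /eqP.
  apply/eqP; apply: (mulfI p30); rewrite mulr0.
  apply: (lin_eq (eqD e (eqD (eqM (- (x ^+ 3 * y ^+ 2 - y ^+ 3 * x ^+ 2)) m1)
       (eqD (eqM (- (x ^+ 3 * y - y ^+ 3 * x)) m2)
       (eqD (eqM (- (x ^+ 2 * y - y ^+ 2 * x)) m3) 
       (eqD (eqM (- (x ^+ 2 - y ^+ 2)) m4) (eqD (eqM (- (x - y)) m5)
        (eqM (- (d * s d - a * s a) * (x ^+ 2 * y - x * y ^+ 2)) c3)))))))).
  by rewrite /cform; ring.
- by have [_ /(_ hr)[nv inj]] := degree1_permuting sE habcd deg.
Qed.
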